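(* Let $(X,d)$ be a Polish metric space and $G$ a closed subgroup of $\mathrm{Iso}(X,d)$ whose action on $(X,d)$ is approximately oligomorphic. Let $\tau$ be the topology of pointwise convergence on $G$ and $\partial(g,h)=\sup_{x\in X}d(gx,hx)$ the metric of uniform convergence, and assume that $(G,\tau,\partial)$ has ample generics. Then $(G,\partial)$ is metrically $21$-Bergman.
   Context: The action of $G$ by isometries on $(X,d)$ is approximately oligomorphic if for every $n\in\mathbb N$ and $\varepsilon>0$ there exist $\bar b_1,\dots,\bar b_k\in X^n$ such that for every $\bar x\in X^n$ there are $j\in\{1,\dots,k\}$ and $g\in G$ with $d(g\cdot\bar b_j,\bar x)\le\varepsilon$ ($X^n$ with the supremum metric). For $A$ in a metric space, $(A)_\varepsilon=\{y\colon\partial(y,A)<\varepsilon\}$. $(G,\tau,\partial)$ has ample generics if for all $n\in\mathbb N$ and $\varepsilon>0$ there is $\bar g\in G^n$ such that $(\{(kg_0k^{-1},\dots,kg_{n-1}k^{-1})\colon k\in G\})_\varepsilon$ is co-meagre in $(G^n,\tau)$, where $G^n$ has the supremum metric. $(G,\partial)$ is metrically $k$-Bergman if whenever $W_0\subseteq W_1\subseteq\cdots$ is an increasing sequence of subsets of $G$ with $\bigcup_nW_n=G$, for every $\varepsilon>0$ there is $n$ with $\big((W_n)_\varepsilon\big)^k=G$. *)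

(* Defs.v *)
From Stdlib Require Import Reals List.
Open Scope R_scope.

Definition is_metric {X : Type} (d : X -> X -> R) : Prop :=
  (forall x y, 0 <= d x y) /\
  (forall x y, d x y = 0 <-> x = y) /\
  (forall x y, d x y = d y x) /\
  (forall x y z, d x z <= d x y + d y z).

Definition cauchy_seq {X : Type} (d : X -> X -> R) (u : nat -> X) : Prop :=
  forall eps, 0 < eps -> exists N, forall m n, (N <= m)%nat -> (N <= n)%nat ->
    d (u m) (u n) < eps.

Definition converges_to {X : Type} (d : X -> X -> R) (u : nat -> X) (l : X) : Prop :=
  forall eps, 0 < eps -> exists N, forall n, (N <= n)%nat -> d (u n) l < eps.

Definition complete_metric {X : Type} (d : X -> X -> R) : Prop :=
  forall u, cauchy_seq d u -> exists l, converges_to d u l.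

Definition separable_metric {X : Type} (d : X -> X -> R) : Prop :=
  exists s : nat -> X, forall x eps, 0 < eps -> exists n, d x (s n) < eps.

Definition polish_metric {X : Type} (d : X -> X -> R) : Prop :=
  is_metric d /\ complete_metric d /\ separable_metric d.

Definition surj_isometry {X : Type} (d : X -> X -> R) (g : X -> X) : Prop :=
  (forall x y, d (g x) (g y) = d x y) /\ (forall y, exists x, g x = y).

Definition iso_subgroup {X : Type} (d : X -> X -> R) (G : (X -> X) -> Prop) : Prop :=
  (forall g, G g -> surj_isometry d g) /\
  G (fun x => x) /\
  (forall g h, G g -> G h -> G (fun x => g (h x))) /\
  (forall g, G g -> exists h, G h /\ (forall x, h (g x) = x) /\ (forall x, g (h x) = x)).

Definition pointwise_closed_in_iso {X : Type} (d : X -> X -> R)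
    (G : (X -> X) -> Prop) : Prop :=
  forall f, surj_isometry d f ->
    (forall (F : list X) eps, 0 < eps ->
       exists g, G g /\ forall x, In x F -> d (g x) (f x) < eps) ->
    G f.

(** * Approximately oligomorphic actions.  X^n is represented by [nat -> X],
    only coordinates i < n being relevant; the metric on X^n is the supremum. *)
Definition approx_oligomorphic {X : Type} (d : X -> X -> R)
    (G : (X -> X) -> Prop) : Prop :=
  forall (n : nat) eps, 0 < eps ->
    exists bs : list (nat -> X),
      forall xb : nat -> X, exists b g, In b bs /\ G g /\
        forall i, (i < n)%nat -> d (g (b i)) (xb i) <= eps.

(** * The topology tau^n (pointwise convergence, product) on G^n.
    G^n is represented by [nat -> (X -> X)] with coordinates i < n in G. *)

Definition in_Gn {X : Type} (G : (X -> X) -> Prop) (n : nat) (gb : nat -> X -> X) : Prop :=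
  forall i, (i < n)%nat -> G (gb i).

Definition tau_nbhd {X : Type} (d : X -> X -> R) (G : (X -> X) -> Prop) (n : nat)
    (gb : nat -> X -> X) (F : list X) (delta : R) (hb : nat -> X -> X) : Prop :=
  in_Gn G n hb /\
  forall i x, (i < n)%nat -> In x F -> d (hb i x) (gb i x) < delta.

Definition tau_open {X : Type} (d : X -> X -> R) (G : (X -> X) -> Prop) (n : nat)
    (U : (nat -> X -> X) -> Prop) : Prop :=
  forall gb, in_Gn G n gb -> U gb ->
    exists (F : list X) delta, 0 < delta /\
      forall hb, tau_nbhd d G n gb F delta hb -> U hb.

Definition tau_dense {X : Type} (d : X -> X -> R) (G : (X -> X) -> Prop) (n : nat)
    (A : (nat -> X -> X) -> Prop) : Prop :=
  forall gb (F : list X) delta, in_Gn G n gb -> 0 < delta ->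
    exists hb, tau_nbhd d G n gb F delta hb /\ A hb.

Definition tau_comeagre {X : Type} (d : X -> X -> R) (G : (X -> X) -> Prop) (n : nat)
    (A : (nat -> X -> X) -> Prop) : Prop :=
  exists U : nat -> (nat -> X -> X) -> Prop,
    (forall m, tau_open d G n (U m) /\ tau_dense d G n (U m)) /\
    (forall hb, in_Gn G n hb -> (forall m, U m hb) -> A hb).

(** * The metric of uniform convergence and neighbourhoods.
    [sup_dist_lt d f g eps] : partial(f,g) = sup_x d(f x, g x) < eps
    (partial may be +infinity; strict inequality of the supremum means some
    delta < eps bounds all distances). *)
Definition sup_dist_lt {X : Type} (d : X -> X -> R) (f g : X -> X) (eps : R) : Prop :=
  exists delta, delta < eps /\ forall x, d (f x) (g x) <= delta.

Definition sup_dist_n_lt {X : Type} (d : X -> X -> R) (n : nat)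
    (fb gb : nat -> X -> X) (eps : R) : Prop :=
  exists delta, delta < eps /\
    forall i x, (i < n)%nat -> d (fb i x) (gb i x) <= delta.

Definition conj_orbit {X : Type} (G : (X -> X) -> Prop) (n : nat)
    (gb : nat -> X -> X) (hb : nat -> X -> X) : Prop :=
  exists k kinv, G k /\ G kinv /\ (forall x, kinv (k x) = x) /\ (forall x, k (kinv x) = x) /\
    forall i, (i < n)%nat -> hb i = (fun x => k (gb i (kinv x))).

Definition nbhd_n {X : Type} (d : X -> X -> R) (G : (X -> X) -> Prop) (n : nat)
    (A : (nat -> X -> X) -> Prop) (eps : R) (hb : nat -> X -> X) : Prop :=
  in_Gn G n hb /\ exists ab, A ab /\ sup_dist_n_lt d n hb ab eps.

Definition ample_generics {X : Type} (d : X -> X -> R) (G : (X -> X) -> Prop) : Prop :=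
  forall (n : nat) eps, 0 < eps ->
    exists gb, in_Gn G n gb /\
      tau_comeagre d G n (nbhd_n d G n (conj_orbit G n gb) eps).

Definition nbhd1 {X : Type} (d : X -> X -> R) (G : (X -> X) -> Prop)
    (W : (X -> X) -> Prop) (eps : R) (h : X -> X) : Prop :=
  G h /\ exists w, W w /\ sup_dist_lt d h w eps.

Definition compose_list {X : Type} (hs : list (X -> X)) : X -> X :=
  fold_right (fun h acc => fun x => h (acc x)) (fun x => x) hs.

Definition power_covers {X : Type} (G : (X -> X) -> Prop) (A : (X -> X) -> Prop)
    (k : nat) : Prop :=
  forall g, G g -> exists hs : list (X -> X),
    length hs = k /\ (forall h, In h hs -> A h) /\ g = compose_list hs.

Definition metrically_bergman {X : Type} (d : X -> X -> R) (G : (X -> X) -> Prop)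
    (k : nat) : Prop :=
  forall W : nat -> (X -> X) -> Prop,
    (forall m g, W m g -> G g) ->
    (forall m g, W m g -> W (S m) g) ->
    (forall g, G g -> exists m, W m g) ->
    forall eps, 0 < eps -> exists m, power_covers G (nbhd1 d G (W m) eps) k.

(* Main.v *)
(** Kechris and Rosendal's argument, with errors. [G] with the topology [tau] is a
    Polish group, so some [W m] is nonmeagre in every open subset of some open set [u],
    and so are all its translates by elements close to the identity on a smaller open set.
    Suppose that for every [n] some [k n] close to the identity is not within [eps] of
    a product of six elements of [W n] or their inverses. Ample generics give a Cantor
    scheme: a node at level [n] carries an "approximately generic" tuple, which is extended
    by some [a] in [W n] on the left and by some [b] in [k n W n] on the right, where a
    small [f] almost commuting with the tuple conjugates [b] almost to [a]. The products of
    the [f]'s along a branch [alpha] converge to [g alpha]; for two branches splitting at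
    level [n] the conjugates of [a] by [g alpha] and of [b] by [g beta] are uniformly close.
    As there are more than countably many branches, two of them split at a level [n] with
    both limits in [W n], and solving for [k n] gives six factors, a contradiction.
    So a product of six factors covers a pointwise neighbourhood [V] of the identity, up to
    [eps]; approximate oligomorphy gives [G = V L V] with [L] finite, hence 13 factors. *)

Require Import Defs.
From Stdlib Require Import Reals List Lra Lia Classical IndefiniteDescription
  FunctionalExtensionality ProofIrrelevance Cantor.
Open Scope R_scope.

(** * Baire category over a countable basis *)

Section Category.
Context {P : Type} (N : nat -> P -> Prop).

Definition basic_sub (i j : nat) : Prop := forall p, N i p -> N j p.

Definition nowhere_dense (A : P -> Prop) : Prop :=
  forall i p, N i p -> exists j q, N j q /\ basic_sub j i /\ forall r, N j r -> ~ A r.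

Definition meagre (A : P -> Prop) : Prop :=
  exists F : nat -> P -> Prop,
    (forall n, nowhere_dense (F n)) /\ forall p, A p -> exists n, F n p.

Definition everywhere_nonmeagre (A : P -> Prop) (u : nat) : Prop :=
  forall j q, N j q -> basic_sub j u -> ~ meagre (fun p => A p /\ N j p).

Lemma meagre_sub (A B : P -> Prop) :
  (forall p, A p -> B p) -> meagre B -> meagre A.
Proof.
  intros H [F [HF HB]]. exists F. split; auto.
Qed.

Lemma meagre_nowhere_dense (A : P -> Prop) : nowhere_dense A -> meagre A.
Proof.
  intros H. exists (fun _ => A). split; auto. intros p Hp. now exists 0%nat.
Qed.

Lemma meagre_bigcup (A : nat -> P -> Prop) :
  (forall n, meagre (A n)) -> meagre (fun p => exists n, A n p).
Proof.
  intros H. apply functional_choice in H. destruct H as [F HF].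
  exists (fun n => F (fst (of_nat n)) (snd (of_nat n))). split.
  - intros n. apply HF.
  - intros p [n Hn]. destruct (proj2 (HF n) p Hn) as [m Hm].
    exists (to_nat (n, m)). now rewrite cancel_of_to.
Qed.

Lemma meagre_or (A B : P -> Prop) :
  meagre A -> meagre B -> meagre (fun p => A p \/ B p).
Proof.
  intros HA HB.
  apply meagre_sub with (fun p => exists n : nat, match n with O => A p | _ => B p end).
  - intros p [H | H]; [now exists 0%nat | now exists 1%nat].
  - apply (meagre_bigcup (fun n p => match n with O => A p | _ => B p end)).
    intros [|n]; assumption.
Qed.

Lemma nonmeagre_meets (A D : P -> Prop) :
  ~ meagre A -> meagre (fun p => ~ D p) -> exists p, A p /\ D p.
Proof.
  intros HA HD. apply NNPP. intros H. apply HA.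
  apply meagre_sub with (2 := HD). intros p Hp Dp. apply H. now exists p.
Qed.

Lemma everywhere_nonmeagre_sub (A B : P -> Prop) (u v : nat) :
  (forall p, A p -> B p) -> basic_sub v u ->
  everywhere_nonmeagre A u -> everywhere_nonmeagre B v.
Proof.
  intros H Hvu HA j q Hj Hjv Hm. apply (HA j q Hj).
  - intros p Hp. auto.
  - apply meagre_sub with (2 := Hm). intros p [? ?]. auto.
Qed.

(** This is the Banach category theorem for a countable basis. The part of [A] lying in basic sets
    where [A] is meagre is a countable union of meagre sets; if no [u] worked, the remaining part
    would be nowhere dense. *)
Lemma nonmeagre_somewhere (A : P -> Prop) :
  ~ meagre A -> exists u p, N u p /\ everywhere_nonmeagre A u.
Proof.
  intros HA. apply NNPP. intros H. apply HA.
  set (Z := fun p => exists i, meagre (fun q => A q /\ N i q) /\ N i p).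
  apply meagre_sub with (fun p => (exists i, meagre (fun q => A q /\ N i q) /\ A p /\ N i p)
                                  \/ (A p /\ ~ Z p)).
  { intros p Hp. destruct (classic (Z p)) as [[i [Hi Hip]] | Hz].
    - left. exists i. auto.
    - right. auto. }
  apply meagre_or.
  - apply (meagre_bigcup (fun i p => meagre (fun q => A q /\ N i q) /\ A p /\ N i p)).
    intros i. destruct (classic (meagre (fun q => A q /\ N i q))) as [Hi | Hi].
    + apply meagre_sub with (2 := Hi). tauto.
    + apply meagre_nowhere_dense. intros j p Hj. exists j, p. repeat split; auto.
      * intros r; auto.
      * tauto.
  - apply meagre_nowhere_dense. intros i p Hp.
    apply NNPP. intros Hno. apply H. exists i, p. split; auto.
    intros j q Hj Hji Hm. apply Hno. exists j, q. repeat split; auto.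
    intros r Hr [_ HZ]. apply HZ. exists j. auto.
Qed.

(* [child k i j]: [N j] is a refinement of [N i] which is small at level [k];
   the hypotheses on it amount to regularity and complete metrizability. *)
Hypothesis basic_inter : forall i j p, N i p -> N j p ->
  exists k, N k p /\ basic_sub k i /\ basic_sub k j.
Variable child : nat -> nat -> nat -> Prop.
Hypothesis child_sub : forall k i j, child k i j -> basic_sub j i.
Hypothesis child_mono : forall k i i' j, basic_sub i i' -> child k i j -> child k i' j.
Hypothesis child_cover : forall k i p, N i p -> exists j, child k i j /\ N j p.
Hypothesis child_complete : forall s : nat -> nat,
  (forall k, child k (s k) (s (S k))) -> (forall k, exists p, N (s k) p) ->
  exists p, (forall k, N (s k) p) /\ forall j, N j p -> exists k, basic_sub (s k) j.

(** Dependent choice along [child]: [T k i] is the invariant kept at level [k], and [child_complete]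
    turns the chosen branch into a point. *)
Lemma child_branch (T : nat -> nat -> Prop) (i0 : nat) :
  (forall i k, T k i -> exists p, N i p) ->
  T 0%nat i0 ->
  (forall k i, T k i -> exists j, child k i j /\ T (S k) j) ->
  exists (s : nat -> nat) (p : P), s 0%nat = i0 /\
    (forall k, child k (s k) (s (S k)) /\ T k (s k) /\ N (s k) p) /\
    forall j, N j p -> exists k, basic_sub (s k) j.
Proof.
  intros HT H0 HS.
  assert (Hc : forall ki : nat * nat, exists j, T (fst ki) (snd ki) ->
             child (fst ki) (snd ki) j /\ T (S (fst ki)) j).
  { intros [k i]. simpl. destruct (classic (T k i)) as [Hk | Hk].
    - destruct (HS k i Hk) as [j Hj]. now exists j.
    - exists 0%nat. tauto. }
  apply functional_choice in Hc. destruct Hc as [f Hf].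
  set (s := fix s k := match k with O => i0 | S k => f (k, s k) end).
  assert (Hs : forall k, T k (s k)).
  { induction k; simpl; auto. apply (Hf (k, s k)). exact IHk. }
  destruct (child_complete s) as [p [Hp1 Hp2]].
  - intros k. apply (Hf (k, s k)). apply Hs.
  - intros k. apply (HT (s k) k). apply Hs.
  - exists s, p. split; [reflexivity|]. split; [|exact Hp2].
    intros k. split; [|auto]. apply (Hf (k, s k)). apply Hs.
Qed.

Lemma baire (p0 : P) : (exists i, N i p0) -> ~ meagre (fun _ => True).
Proof.
  intros [i0 H0] [F [HF Hcov]].
  (* Level [S m] of the branch avoids [F m], so the limit point escapes every member of the
     cover. *)
  set (T := fun k i => (exists p, N i p) /\
              match k with O => True | S m => forall r, N i r -> ~ F m r end).
  destruct (child_branch T i0) as [s [p [_ [Hs _]]]].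
  - intros i k [H _]. exact H.
  - split; [now exists p0 | exact I].
  - intros k i [[p Hp] _]. destruct (HF k i p Hp) as [j [q [Hj [Hji Hav]]]].
    destruct (child_cover k j q Hj) as [l [Hl Hlq]].
    exists l. split; [now apply child_mono with j|]. split; [now exists q|].
    intros r Hr. apply Hav. now apply (child_sub k j l).
  - destruct (Hcov p I) as [n Hn].
    destruct (Hs (S n)) as [_ [[_ Hav] HN]]. exact (Hav p HN Hn).
Qed.

(** * Projections of closed relations *)

Definition closed_rel (E : P -> P -> Prop) : Prop :=
  forall g y, (forall a b, N a g -> N b y -> exists g' y', N a g' /\ N b y' /\ E g' y') -> E g y.

Definition proj (E : P -> P -> Prop) (i : nat) (y : P) : Prop := exists g, N i g /\ E g y.

Definition locally_big (E : P -> P -> Prop) (i : nat) (y : P) : Prop :=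
  exists l, N l y /\ everywhere_nonmeagre (proj E i) l.

(** The children of [i] cover [N i], so [proj E i] is the countable union of the sets [proj E j].
    Where [proj E i] is everywhere nonmeagre, one of these is nonmeagre, hence everywhere nonmeagre
    on some smaller basic set. *)
Lemma locally_big_child (E : P -> P -> Prop) (k i : nat) :
  nowhere_dense (fun y => locally_big E i y /\ ~ exists j, child k i j /\ locally_big E j y).
Proof.
  intros l p Hp.
  destruct (classic (exists y, N l y /\ locally_big E i y)) as [[y [Hy [l' [Hl' Hb]]]] | Hno].
  2: { exists l, p. repeat split; auto.
       - intros r; auto.
       - intros r Hr [Hr' _]. apply Hno. now exists r. }
  destruct (basic_inter l l' y Hy Hl') as [m [Hm [Hml Hml']]].
  assert (Hj : exists j, child k i j /\ ~ meagre (fun z => proj E j z /\ N m z)).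
  { apply NNPP. intros Hno. apply (Hb m y Hm Hml').
    apply meagre_sub with (fun z => exists j, child k i j /\ proj E j z /\ N m z).
    - intros z [[g [Hg HE]] Hz]. destruct (child_cover k i g Hg) as [j [Hj Hjg]].
      exists j. repeat split; auto. now exists g.
    - apply (meagre_bigcup (fun j z => child k i j /\ proj E j z /\ N m z)). intros j.
      destruct (classic (meagre (fun z => proj E j z /\ N m z))) as [Hj | Hj].
      + apply meagre_sub with (2 := Hj). tauto.
      + apply meagre_nowhere_dense. intros a b Hab. exists a, b.
        repeat split; auto; [intros r; auto|].
        intros r _ [Hc _]. apply Hno. now exists j. }
  destruct Hj as [j [Hj Hnm]].
  destruct (nonmeagre_somewhere _ Hnm) as [v [q [Hv Hbv]]].
  assert (Hq : exists q', N v q' /\ N m q').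
  { apply NNPP. intros Hno. apply (Hbv v q Hv).
    - intros r; auto.
    - apply meagre_nowhere_dense. intros a b Hab. exists a, b.
      repeat split; auto; [intros r; auto|].
      intros r _ [[_ Hr] Hr']. apply Hno. now exists r. }
  destruct Hq as [q' [Hq1 Hq2]].
  destruct (basic_inter v m q' Hq1 Hq2) as [w [Hw [Hwv Hwm]]].
  exists w, q'. split; [exact Hw|]. split; [intros r Hr; apply Hml; auto|].
  intros r Hr [_ Hn]. apply Hn. exists j. split; [exact Hj|].
  exists w. split; [exact Hr|].
  apply everywhere_nonmeagre_sub with (3 := Hbv); [tauto | exact Hwv].
Qed.

(* A weak form of the Baire property of analytic sets: off a meagre set, one can
   follow nested refinements of [N i] over which the projection stays locally big. *)
Lemma locally_big_proj (E : P -> P -> Prop) : closed_rel E ->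
  forall i, meagre (fun y => locally_big E i y /\ ~ proj E i y).
Proof.
  intros HE i.
  apply meagre_sub with (fun y => exists k i', locally_big E i' y /\
                           ~ exists j, child k i' j /\ locally_big E j y).
  2: { apply (meagre_bigcup (fun k y => exists i', locally_big E i' y /\
                           ~ exists j, child k i' j /\ locally_big E j y)). intros k.
       apply (meagre_bigcup (fun i' y => locally_big E i' y /\
                           ~ exists j, child k i' j /\ locally_big E j y)).
       intros i'. apply meagre_nowhere_dense. apply locally_big_child. }
  intros y [Hy Hn]. apply NNPP. intros Hno. apply Hn.
  assert (Hmeet : forall i' b, locally_big E i' y -> N b y ->
            exists g' y', N i' g' /\ N b y' /\ E g' y').
  { intros i' b [l [Hl Hb]] Hby. apply NNPP. intros Hno'.
    destruct (basic_inter l b y Hl Hby) as [m [Hm [Hml Hmb]]].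
    apply (Hb m y Hm Hml). apply meagre_nowhere_dense. intros a c Hac. exists a, c.
    repeat split; auto; [intros r; auto|].
    intros r _ [[g [Hg HgE]] Hr]. apply Hno'. exists g, r. auto. }
  (* Since [y] avoids the exceptional sets, refinements that are big at [y] never run out. By
     [Hmeet] every box around the limit [g] and [y] meets [E], and closedness yields [E g y]. *)
  destruct (child_branch (fun _ i' => locally_big E i' y) i) as [s [g [Hs0 [Hs Hconv]]]].
  - intros i' _ Hi'. destruct Hi' as [l [Hl Hb]].
    destruct (Hmeet i' l) as [g' [_ [Hg' _]]]; [now exists l | exact Hl | now exists g'].
  - exact Hy.
  - intros k i' Hi'. apply NNPP. intros Hno'. apply Hno. now exists k, i'.
  - exists g. split; [rewrite <- Hs0; apply Hs|].
    apply HE. intros a b Ha Hb. destruct (Hconv a Ha) as [k Hk].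
    destruct (Hmeet (s k) b) as [g' [y' [H1 [H2 H3]]]]; [apply Hs | exact Hb |].
    exists g', y'. auto.
Qed.

(** Almost every [y] has a section, and countably many indices in [I] cover the sections, so for one
    [i] the set [proj E i] is everywhere nonmeagre on some basic [w] inside [u]. By
    [locally_big_proj] almost all of [w] then lies in [proj E i], and [A] and [B] both meet it
    there. The gain is that both sections lie in the same small set [N i]. *)
Lemma common_section (E : P -> P -> Prop) (A B D : P -> Prop) (I : nat -> Prop) (u : nat) :
  closed_rel E ->
  (exists p, N u p) -> everywhere_nonmeagre A u -> everywhere_nonmeagre B u ->
  meagre (fun y => ~ exists g, E g y) -> meagre (fun y => ~ D y) ->
  (forall g, exists i, I i /\ N i g) ->
  exists i a b ga gb, I i /\ A a /\ D a /\ B b /\ D b /\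
    N i ga /\ N i gb /\ E ga a /\ E gb b.
Proof.
  intros HE [p Hp] HA HB HEm HDm HI.
  assert (Hi : exists i, I i /\ ~ meagre (fun y => proj E i y /\ N u y)).
  { apply NNPP. intros Hno. apply (HA u p Hp); [intros r; auto|].
    apply meagre_sub with (fun y => (~ exists g, E g y) \/
                              exists i, I i /\ proj E i y /\ N u y).
    - intros y [_ Hy]. destruct (classic (exists g, E g y)) as [[g Hg] | Hg]; [|now left].
      right. destruct (HI g) as [i [Hi Hig]]. exists i. repeat split; auto. now exists g.
    - apply meagre_or; [exact HEm|].
      apply (meagre_bigcup (fun i y => I i /\ proj E i y /\ N u y)). intros i.
      destruct (classic (meagre (fun z => proj E i z /\ N u z))) as [Hj | Hj].
      + apply meagre_sub with (2 := Hj). tauto.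
      + apply meagre_nowhere_dense. intros a b Hab. exists a, b.
        repeat split; auto; [intros r; auto|].
        intros r _ [Hc _]. apply Hno. now exists i. }
  destruct Hi as [i [Hi Hnm]].
  destruct (nonmeagre_somewhere _ Hnm) as [v [q [Hv Hbv]]].
  destruct (nonmeagre_meets (fun y => (proj E i y /\ N u y) /\ N v y) (fun _ => True))
    as [q' [[[_ Hq1] Hq2] _]].
  { apply (Hbv v q Hv). intros r; auto. }
  { apply meagre_nowhere_dense. intros a b Hab. exists a, b.
    repeat split; auto; intros r; auto. }
  destruct (basic_inter u v q' Hq1 Hq2) as [w [Hw [Hwu Hwv]]].
  assert (Hbw : everywhere_nonmeagre (proj E i) w).
  { apply everywhere_nonmeagre_sub with (3 := Hbv); [tauto | exact Hwv]. }
  assert (Hpick : forall C, everywhere_nonmeagre C u ->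
             exists y g, C y /\ D y /\ N i g /\ E g y).
  { intros C HC.
    destruct (nonmeagre_meets (fun y => C y /\ N w y)
                (fun y => D y /\ ~ (locally_big E i y /\ ~ proj E i y))) as [y [[Hy1 Hy2] [Hy3 Hy4]]].
    - exact (HC w q' Hw Hwu).
    - apply meagre_sub with (fun y => ~ D y \/ (locally_big E i y /\ ~ proj E i y)).
      + intros y Hy. apply not_and_or in Hy. destruct Hy as [Hy | Hy]; [now left|].
        right. now apply NNPP.
      + apply meagre_or; [exact HDm | now apply locally_big_proj].
    - apply not_and_or in Hy4. destruct Hy4 as [Hy4 | Hy4].
      + exfalso. apply Hy4. now exists w.
      + apply NNPP in Hy4. destruct Hy4 as [g [Hg1 Hg2]]. now exists y, g. }
  destruct (Hpick A HA) as [a [ga [Ha1 [Ha2 [Ha3 Ha4]]]]].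
  destruct (Hpick B HB) as [b [gb [Hb1 [Hb2 [Hb3 Hb4]]]]].
  exists i, a, b, ga, gb. repeat split; auto.
Qed.

End Category.

(** * Diagonalization, codes of finite lists, and geometric bounds *)

(** A quantitative form of the uncountability of Cantor space. If no such pair exists, each prefix
    of length [m] has a next bit that no branch of [T m] through the prefix takes; the branch
    following these avoided bits lies in no [T m]. *)
Lemma split_branches (T : nat -> (nat -> bool) -> Prop) :
  (forall al, exists m, T m al) ->
  exists n al be, (forall i, (i < n)%nat -> al i = be i) /\ al n = false /\ be n = true /\
    T n al /\ T n be.
Proof.
  intros HT. apply NNPP. intros Hno.
  assert (Hbit : forall mp : nat * (nat -> bool), exists c, forall al,
             T (fst mp) al -> (forall i, (i < fst mp)%nat -> al i = snd mp i) -> al (fst mp) <> c).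
  { intros [m p]. simpl. apply NNPP. intros Hc.
    assert (H : forall c, exists al, T m al /\ (forall i, (i < m)%nat -> al i = p i) /\ al m = c).
    { intros c. apply NNPP. intros H. apply Hc. exists c. intros al H1 H2 H3. apply H.
      now exists al. }
    destruct (H false) as [al [A1 [A2 A3]]]. destruct (H true) as [be [B1 [B2 B3]]].
    apply Hno. exists m, al, be. repeat split; auto.
    intros i Hi. now rewrite A2, B2. }
  apply functional_choice in Hbit. destruct Hbit as [bit Hbit].
  (* [pre m] stores the first [m] bits of the diagonal branch [ga], padded with [false]. *)
  set (pre := fix pre m := match m with
     | O => fun _ => false
     | S m => fun i => if Nat.eqb i m then bit (m, pre m) else pre m i
     end).
  set (ga := fun m => bit (m, pre m)).
  assert (Hpre : forall m i, (i < m)%nat -> ga i = pre m i).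
  { induction m as [|m IH]; intros i Hi; [lia|]. cbn [pre].
    destruct (Nat.eqb_spec i m) as [-> | Hne]; [reflexivity|]. apply IH. lia. }
  destruct (HT ga) as [m Hm]. apply (Hbit (m, pre m) ga); simpl; auto.
Qed.

(** The fuel [k] is the length of the list; [decode] reads it from the code itself, so every natural
    number codes a list. *)
Fixpoint decode_fuel (k n : nat) : list nat :=
  match k with
  | O => nil
  | S k => fst (of_nat n) :: decode_fuel k (snd (of_nat n))
  end.

Definition decode (n : nat) : list nat := decode_fuel (fst (of_nat n)) (snd (of_nat n)).

Lemma decode_surj (l : list nat) : exists n, decode n = l.
Proof.
  assert (H : exists m, decode_fuel (length l) m = l).
  { induction l as [|a l [m Hm]]; [now exists 0%nat|].
    exists (to_nat (a, m)). cbn [length decode_fuel].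
    now rewrite cancel_of_to; cbn [fst snd]; rewrite Hm. }
  destruct H as [m Hm]. exists (to_nat (length l, m)).
  unfold decode. now rewrite cancel_of_to.
Qed.

Lemma inv_INR_lt (eps : R) : 0 < eps -> exists q, / INR (S q) < eps.
Proof.
  intros He. destruct (archimed_cor1 eps He) as [n [Hn Hn0]].
  destruct n as [|q]; [lia|]. now exists q.
Qed.

Lemma half_pow_lt (eps : R) : 0 < eps -> exists K, forall n, (K <= n)%nat -> (1/2)^n < eps.
Proof.
  intros He. destruct (pow_lt_1_zero (1/2)) with (y := eps) as [K HK]; auto.
  - rewrite Rabs_pos_eq; lra.
  - exists K. intros n Hn. specialize (HK n Hn).
    rewrite Rabs_pos_eq in HK; auto. apply pow_le. lra.
Qed.

Lemma half_pow_pos (n : nat) : 0 < (1/2)^n.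
Proof. apply pow_lt. lra. Qed.

Lemma half_pow_le_1 (n : nat) : (1/2)^n <= 1.
Proof. rewrite <- (pow1 n) at 2. apply pow_incr. lra. Qed.

(** * The topological group *)

Section IsometryGroup.
Context {X : Type} (d : X -> X -> R) (G : (X -> X) -> Prop).
Hypothesis metric : is_metric d.
Hypothesis complete : complete_metric d.
Variable s : nat -> X.
Hypothesis s_dense : forall x eps, 0 < eps -> exists n, d x (s n) < eps.
Hypothesis subgroup : iso_subgroup d G.
Hypothesis closed : pointwise_closed_in_iso d G.

Lemma dist_pos x y : 0 <= d x y.
Proof. apply metric. Qed.

Lemma dist_sym x y : d x y = d y x.
Proof. apply metric. Qed.

Lemma dist_tri x y z : d x z <= d x y + d y z.
Proof. apply metric. Qed.

Lemma dist_refl x : d x x = 0.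
Proof. now apply metric. Qed.

(** The bound is the exact partial sum of the geometric series, which lets the induction on [k]
    close. *)
Lemma dist_geometric (v : nat -> X) (c : R) (l : nat) :
  (forall n, (l <= n)%nat -> d (v (S n)) (v n) <= c * (1/2)^n) ->
  forall n k, (l <= n)%nat -> d (v (n + k)%nat) (v n) <= 2 * c * ((1/2)^n - (1/2)^(n + k)).
Proof.
  intros H n k Hn. induction k as [|k IH].
  - rewrite Nat.add_0_r, dist_refl. lra.
  - rewrite Nat.add_succ_r.
    pose proof (dist_tri (v (S (n + k))) (v (n + k)%nat) (v n)).
    assert (Hk : (l <= n + k)%nat) by lia.
    pose proof (H (n + k)%nat Hk). simpl. lra.
Qed.

Definition Elt : Type := {g : X -> X | G g}.
Definition ap (g : Elt) : X -> X := proj1_sig g.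

Lemma elt_ext (g h : Elt) : (forall x, ap g x = ap h x) -> g = h.
Proof.
  intros H. apply eq_sig_hprop; [intros; apply proof_irrelevance|].
  now apply functional_extensionality.
Qed.

Definition one : Elt := exist _ (fun x => x) (proj1 (proj2 subgroup)).

Definition mul (g h : Elt) : Elt :=
  exist _ (fun x => ap g (ap h x))
    (proj1 (proj2 (proj2 subgroup)) _ _ (proj2_sig g) (proj2_sig h)).

Lemma inverse_exists (g : Elt) :
  exists h : Elt, (forall x, ap h (ap g x) = x) /\ (forall x, ap g (ap h x) = x).
Proof.
  destruct subgroup as [_ [_ [_ Hinv]]].
  destruct (Hinv (ap g) (proj2_sig g)) as [h [Hh [H1 H2]]].
  exists (exist _ h Hh). split; assumption.
Qed.

Definition inv (g : Elt) : Elt :=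
  proj1_sig (constructive_indefinite_description _ (inverse_exists g)).

Lemma inv_ap g x : ap (inv g) (ap g x) = x.
Proof. apply (proj2_sig (constructive_indefinite_description _ (inverse_exists g))). Qed.

Lemma ap_inv g x : ap g (ap (inv g) x) = x.
Proof. apply (proj2_sig (constructive_indefinite_description _ (inverse_exists g))). Qed.

Lemma ap_iso g x y : d (ap g x) (ap g y) = d x y.
Proof. apply (proj1 subgroup (ap g) (proj2_sig g)). Qed.

Lemma inv_unique g h : (forall x, ap g (ap h x) = x) -> inv g = h.
Proof.
  intros H. apply elt_ext. intros x. now rewrite <- (H x) at 1; rewrite inv_ap.
Qed.

Lemma inv_inv g : inv (inv g) = g.
Proof. apply inv_unique. apply inv_ap. Qed.

Lemma inv_mul g h x : ap (inv (mul g h)) x = ap (inv h) (ap (inv g) x).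
Proof.
  rewrite (inv_unique (mul g h) (mul (inv h) (inv g))); [reflexivity|].
  intros y. simpl. now rewrite !ap_inv.
Qed.

Lemma inv_iso_l g x y : d (ap (inv g) x) y = d x (ap g y).
Proof. now rewrite <- (ap_iso g), ap_inv. Qed.

Lemma inv_iso_r g x y : d x (ap (inv g) y) = d (ap g x) y.
Proof. now rewrite <- (ap_iso g), ap_inv. Qed.

Definition near (F : list X) (delta : R) (g g' : Elt) : Prop :=
  forall p, In p F -> d (ap g' p) (ap g p) < delta.

Definition tends_to (u : nat -> Elt) (g : Elt) : Prop :=
  forall x eps, 0 < eps -> exists K, forall n, (K <= n)%nat -> d (ap (u n) x) (ap g x) < eps.

Lemma tends_to_near u g F delta : tends_to u g -> 0 < delta ->
  exists K, forall n, (K <= n)%nat -> near F delta g (u n).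
Proof.
  intros H Hd. induction F as [|p F [K HK]].
  - exists 0%nat. intros n _ p [].
  - destruct (H p delta Hd) as [K' HK']. exists (max K K'). intros n Hn q [<- | Hq].
    + apply HK'. lia.
    + apply HK; [lia | exact Hq].
Qed.

(** Isometries are equicontinuous, so control on the dense sequence spreads to every point by an
    [eps/3] argument. *)
Lemma cauchy_everywhere (u : nat -> Elt) :
  (forall l eps, 0 < eps -> exists K, forall m n, (K <= m)%nat -> (K <= n)%nat ->
     d (ap (u m) (s l)) (ap (u n) (s l)) < eps) ->
  forall x, cauchy_seq d (fun n => ap (u n) x).
Proof.
  intros H x eps He. destruct (s_dense x (eps/3)) as [l Hl]; [lra|].
  destruct (H l (eps/3)) as [K HK]; [lra|]. exists K. intros m n Hm Hn.
  pose proof (dist_tri (ap (u m) x) (ap (u m) (s l)) (ap (u n) x)).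
  pose proof (dist_tri (ap (u m) (s l)) (ap (u n) (s l)) (ap (u n) x)).
  specialize (HK m n Hm Hn). rewrite !ap_iso in *. rewrite (dist_sym (s l) x) in *. lra.
Qed.

(* Convergence of the inverses is what makes the limit surjective. *)
Lemma limit_exists (u : nat -> Elt) :
  (forall l eps, 0 < eps -> exists K, forall m n, (K <= m)%nat -> (K <= n)%nat ->
     d (ap (u m) (s l)) (ap (u n) (s l)) < eps /\
     d (ap (inv (u m)) (s l)) (ap (inv (u n)) (s l)) < eps) ->
  exists g, tends_to u g.
Proof.
  intros H.
  assert (H1 : forall x, exists y, converges_to d (fun n => ap (u n) x) y).
  { intros x. apply complete, cauchy_everywhere. intros l eps He.
    destruct (H l eps He) as [K HK]. exists K. intros m n Hm Hn. now apply HK. }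
  assert (H2 : forall x, exists y, converges_to d (fun n => ap (inv (u n)) x) y).
  { intros x. apply complete, (cauchy_everywhere (fun n => inv (u n))). intros l eps He.
    destruct (H l eps He) as [K HK]. exists K. intros m n Hm Hn. now apply HK. }
  apply functional_choice in H1. destruct H1 as [f Hf].
  apply functional_choice in H2. destruct H2 as [f' Hf'].
  assert (Hzero : forall a, 0 <= a -> (forall eps, 0 < eps -> a <= eps) -> a = 0).
  { intros a Ha Hb. apply Rle_antisym; [|exact Ha]. apply le_epsilon.
    intros eps He. specialize (Hb eps He). lra. }
  assert (Hiso : surj_isometry d f).
  { split.
    - intros x y. apply Rminus_diag_uniq.
      assert (Habs : Rabs (d (f x) (f y) - d x y) = 0).
      { apply Hzero; [apply Rabs_pos|]. intros eps He.
        destruct (Hf x (eps/2)) as [K1 HK1]; [lra|].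
        destruct (Hf y (eps/2)) as [K2 HK2]; [lra|].
        specialize (HK1 (max K1 K2) ltac:(lia)). specialize (HK2 (max K1 K2) ltac:(lia)).
        set (g := u (max K1 K2)) in *. rewrite <- (ap_iso g x y).
        pose proof (dist_tri (f x) (ap g x) (f y)). pose proof (dist_tri (ap g x) (ap g y) (f y)).
        pose proof (dist_tri (ap g x) (f x) (ap g y)). pose proof (dist_tri (f x) (f y) (ap g y)).
        rewrite (dist_sym (f x) (ap g x)) in *. rewrite (dist_sym (f y) (ap g y)) in *.
        apply Rabs_le. lra. }
      destruct (Req_dec (d (f x) (f y) - d x y) 0) as [E | E]; [exact E|].
      now apply Rabs_no_R0 in E.
    - intros y. exists (f' y). apply metric. apply Hzero; [apply dist_pos|].
      intros eps He.
      destruct (Hf (f' y) (eps/2)) as [K1 HK1]; [lra|].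
      destruct (Hf' y (eps/2)) as [K2 HK2]; [lra|].
      specialize (HK1 (max K1 K2) ltac:(lia)). specialize (HK2 (max K1 K2) ltac:(lia)).
      set (g := u (max K1 K2)) in *. rewrite inv_iso_l in HK2.
      pose proof (dist_tri (f (f' y)) (ap g (f' y)) y).
      rewrite (dist_sym (f (f' y)) (ap g (f' y))) in *. rewrite (dist_sym y) in HK2. lra. }
  assert (HG : G f).
  { apply closed; [exact Hiso|]. intros F eps He.
    assert (HK : exists K, forall n, (K <= n)%nat -> forall x, In x F -> d (ap (u n) x) (f x) < eps).
    { induction F as [|p F [K HK]].
      - exists 0%nat. intros n _ x [].
      - destruct (Hf p eps He) as [K' HK']. exists (max K K'). intros n Hn x [<- | Hx].
        + apply HK'. lia.
        + apply HK; [lia | exact Hx]. }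
    destruct HK as [K HK]. exists (ap (u K)). split; [apply (proj2_sig (u K))|].
    intros x Hx. now apply HK. }
  exists (exist _ f HG). exact Hf.
Qed.

(** * A countable basis of the pointwise topology, and its completeness *)

(** A countable subbasis: [c] codes a triple made of two indices in the dense sequence and a
    precision. Finite intersections, coded by lists, form the basis. *)
Definition constraint (c : nat) (g : Elt) : Prop :=
  let a := fst (of_nat c) in
  let b := fst (of_nat (snd (of_nat c))) in
  let q := snd (of_nat (snd (of_nat c))) in
  d (ap g (s a)) (s b) < / INR (S q).

Definition basic (j : nat) (g : Elt) : Prop := forall c, In c (decode j) -> constraint c g.

Lemma basic_near g F delta : 0 < delta ->
  exists i, basic i g /\ forall g', basic i g' -> near F delta g g'.
Proof.
  intros Hd.
  assert (H : exists l, (forall c, In c l -> constraint c g) /\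
             forall g', (forall c, In c l -> constraint c g') -> near F delta g g').
  { induction F as [|p F [l [Hl1 Hl2]]].
    - exists nil. split; [intros c []|]. intros g' _ p [].
    (* Four errors below [delta/4] separate the images of [p]: two from replacing [p] by [s a], and
       two from comparing both images of [s a] with [s b]. *)
    - destruct (inv_INR_lt (delta/4)) as [q Hq]; [lra|].
      destruct (s_dense p (delta/4)) as [a Ha]; [lra|].
      destruct (s_dense (ap g (s a)) (/ INR (S q))) as [b Hb].
      { apply Rinv_0_lt_compat. apply lt_0_INR. lia. }
      set (c := to_nat (a, to_nat (b, q))).
      assert (Hc : forall g', constraint c g' <-> d (ap g' (s a)) (s b) < / INR (S q)).
      { intros g'. unfold constraint, c. rewrite !cancel_of_to. cbn [fst snd].
        rewrite !cancel_of_to. reflexivity. }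
      exists (c :: l). split.
      + intros c' [<- | Hc']; [now apply Hc | now apply Hl1].
      + intros g' Hg' p' [<- | Hp'].
        * assert (Hcc : constraint c g') by (apply Hg'; now left). apply Hc in Hcc.
          pose proof (dist_tri (ap g' p) (ap g' (s a)) (ap g p)).
          pose proof (dist_tri (ap g' (s a)) (s b) (ap g p)).
          pose proof (dist_tri (s b) (ap g (s a)) (ap g p)).
          rewrite !ap_iso in *. rewrite (dist_sym (s b) (ap g (s a))) in *. rewrite (dist_sym (s a) p) in *. lra.
        * apply Hl2; auto. intros c' Hc'. apply Hg'. now right. }
  destruct H as [l [Hl1 Hl2]]. destruct (decode_surj l) as [i Hi].
  exists i. unfold basic. rewrite Hi. auto.
Qed.

Lemma near_basic i g : basic i g ->
  exists F delta, 0 < delta /\ forall g', near F delta g g' -> basic i g'.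
Proof.
  unfold basic. induction (decode i) as [|c l IH]; intros H.
  - exists nil, 1. split; [lra|]. intros g' _ c [].
  - destruct IH as [F [delta [Hd HF]]]; [intros c' Hc'; apply H; now right|].
    assert (Hc : constraint c g) by (apply H; now left). unfold constraint in Hc.
    set (a := fst (of_nat c)) in Hc.
    set (b := fst (of_nat (snd (of_nat c)))) in Hc.
    set (q := snd (of_nat (snd (of_nat c)))) in Hc.
    exists (s a :: F), (Rmin delta (/ INR (S q) - d (ap g (s a)) (s b))). split.
    + apply Rmin_glb_lt; lra.
    + intros g' Hg' c' [<- | Hc'].
      * unfold constraint. fold a b q.
        assert (Ha : d (ap g' (s a)) (ap g (s a)) < Rmin delta (/ INR (S q) - d (ap g (s a)) (s b)))
          by (apply Hg'; now left).
        pose proof (Rmin_r delta (/ INR (S q) - d (ap g (s a)) (s b))).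
        pose proof (dist_tri (ap g' (s a)) (ap g (s a)) (s b)). lra.
      * apply HF; [|exact Hc']. intros p Hp.
        apply Rlt_le_trans with (2 := Rmin_l delta (/ INR (S q) - d (ap g (s a)) (s b))).
        apply Hg'. now right.
Qed.

Lemma near_sub F F' delta delta' g g' :
  incl F' F -> delta <= delta' -> near F delta g g' -> near F' delta' g g'.
Proof.
  intros HF Hd H p Hp. apply Rlt_le_trans with delta; auto.
Qed.

Lemma near_refl F delta g : 0 < delta -> near F delta g g.
Proof. intros Hd p _. now rewrite dist_refl. Qed.

Lemma near_trans F delta delta' g g' g'' :
  near F delta g g' -> near F delta' g' g'' -> near F (delta + delta') g g''.
Proof.
  intros H H' p Hp. pose proof (dist_tri (ap g'' p) (ap g' p) (ap g p)).
  specialize (H p Hp). specialize (H' p Hp). lra.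
Qed.

Lemma near_both F F' delta delta' g : 0 < delta -> 0 < delta' ->
  exists F'' delta'', 0 < delta'' /\
    forall g', near F'' delta'' g g' -> near F delta g g' /\ near F' delta' g g'.
Proof.
  intros H H'. exists (F ++ F'), (Rmin delta delta'). split; [now apply Rmin_glb_lt|].
  intros g' Hg. split; apply near_sub with (3 := Hg); try apply Rmin_l; try apply Rmin_r.
  - now apply incl_appl, incl_refl.
  - now apply incl_appr, incl_refl.
Qed.

Lemma basic_inter_elt i j g : basic i g -> basic j g ->
  exists k, basic k g /\ basic_sub basic k i /\ basic_sub basic k j.
Proof.
  intros Hi Hj. destruct (decode_surj (decode i ++ decode j)) as [k Hk].
  exists k. unfold basic_sub, basic. rewrite Hk. repeat split.
  - intros c Hc. apply in_app_or in Hc. destruct Hc; auto.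
  - intros p Hp c Hc. apply Hp. apply in_or_app. now left.
  - intros p Hp c Hc. apply Hp. apply in_or_app. now right.
Qed.

Definition basic_closure (j : nat) (g : Elt) : Prop :=
  forall F delta, 0 < delta -> exists g', basic j g' /\ near F delta g g'.

(** The closure condition keeps limits inside every set of a branch. The oscillation condition
    covers inverses too, as [limit_exists] requires, and makes the points along a branch Cauchy. *)
Definition refines (k i j : nat) : Prop :=
  (forall g, basic_closure j g -> basic i g) /\
  forall g g', basic j g -> basic j g' -> forall l, (l <= k)%nat ->
    d (ap g (s l)) (ap g' (s l)) < (1/2)^k /\
    d (ap (inv g) (s l)) (ap (inv g') (s l)) < (1/2)^k.

Lemma basic_closure_basic j g : basic j g -> basic_closure j g.
Proof. intros H F delta Hd. exists g. split; [exact H | now apply near_refl]. Qed.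

Lemma refines_sub k i j : refines k i j -> basic_sub basic j i.
Proof. intros [H _] g Hg. now apply H, basic_closure_basic. Qed.

Lemma refines_mono k i i' j : basic_sub basic i i' -> refines k i j -> refines k i' j.
Proof. intros Hi [H1 H2]. split; auto. Qed.

Lemma refines_cover k i g : basic i g -> exists j, refines k i j /\ basic j g.
Proof.
  intros Hi. destruct (near_basic i g Hi) as [F [delta [Hd HF]]].
  set (L := map s (seq 0 (S k))).
  (* The inverses of [g'] and [g] differ at [s l] exactly as much as [g'] and [g] differ at the
     preimage of [s l] under [g], so these preimages are controlled as well. *)
  set (Fk := L ++ map (ap (inv g)) L). set (e := (1/2)^k / 2).
  assert (He : 0 < e) by (unfold e; pose proof (half_pow_pos k); lra).
  destruct (near_both F Fk (delta/2) e g) as [F' [delta' [Hd' HF']]]; [lra | exact He |].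
  destruct (basic_near g F' delta' Hd') as [j [Hj1 Hj2]].
  exists j. split; [|exact Hj1]. split.
  - intros g' Hg'. apply HF. destruct (Hg' F (delta/2)) as [g'' [Hg1 Hg2]]; [lra|].
    replace delta with (delta/2 + delta/2) by lra. apply near_trans with g''.
    + now apply HF', Hj2.
    + intros p Hp. rewrite dist_sym. now apply Hg2.
  - assert (Hl : forall g', basic j g' -> forall l, (l <= k)%nat ->
              d (ap g' (s l)) (ap g (s l)) < e /\ d (ap (inv g') (s l)) (ap (inv g) (s l)) < e).
    { intros g' Hg' l Hl. assert (HL : In (s l) L).
      { apply in_map. apply in_seq. lia. }
      destruct (HF' g' (Hj2 g' Hg')) as [_ Hn]. split.
      - apply Hn. apply in_or_app. now left.
      - rewrite inv_iso_l, dist_sym. rewrite <- (ap_inv g (s l)) at 2.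
        apply Hn. apply in_or_app. right. now apply in_map. }
    intros g1 g2 H1 H2 l Hlk. destruct (Hl g1 H1 l Hlk) as [A1 B1].
    destruct (Hl g2 H2 l Hlk) as [A2 B2].
    rewrite (dist_sym (ap g2 _)) in A2. rewrite (dist_sym (ap (inv g2) _)) in B2.
    pose proof (dist_tri (ap g1 (s l)) (ap g (s l)) (ap g2 (s l))).
    pose proof (dist_tri (ap (inv g1) (s l)) (ap (inv g) (s l)) (ap (inv g2) (s l))).
    unfold e in *. lra.
Qed.

Lemma refines_complete (t : nat -> nat) :
  (forall k, refines k (t k) (t (S k))) -> (forall k, exists g, basic (t k) g) ->
  exists g, (forall k, basic (t k) g) /\
    forall j, basic j g -> exists k, basic_sub basic (t k) j.
Proof.
  intros Ht Hne. apply functional_choice in Hne. destruct Hne as [u Hu].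
  assert (Hmono : forall k m, basic_sub basic (t (m + k)%nat) (t k)).
  { intros k m. induction m as [|m IH]; [intros g; auto|].
    intros g Hg. apply IH. now apply (refines_sub _ _ _ (Ht (m + k)%nat)). }
  assert (Hum : forall k n, (k <= n)%nat -> basic (t k) (u n)).
  { intros k n Hn. replace n with (n - k + k)%nat by lia. apply (Hmono k (n - k)%nat), Hu. }
  destruct (limit_exists u) as [g Hg].
  { intros l eps He. destruct (half_pow_lt eps He) as [K HK].
    exists (S (max K l)). intros m n Hm Hn.
    specialize (HK (max K l) ltac:(lia)).
    destruct (proj2 (Ht (max K l)) (u m) (u n)) with (l := l) as [H1 H2];
      try (apply Hum; lia); [lia|]. lra. }
  assert (Hcl : forall k, basic_closure (t k) g).
  { intros k F delta Hd. destruct (tends_to_near u g F delta Hg Hd) as [K HK].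
    exists (u (max k K)). split; [apply Hum; lia | apply HK; lia]. }
  assert (Hin : forall k, basic (t k) g) by (intros k; apply (Ht k), Hcl).
  exists g. split; [exact Hin|].
  intros j Hj.
  (* A constraint satisfied by [g] has slack, which some level of the branch beats. A basic set
     involves finitely many constraints, so the maximum of their levels suffices. *)
  assert (Hc : forall c, exists k, constraint c g -> forall g', basic (t k) g' -> constraint c g').
  { intros c. unfold constraint. set (a := fst (of_nat c)).
    set (b := fst (of_nat (snd (of_nat c)))). set (q := snd (of_nat (snd (of_nat c)))).
    destruct (Rlt_dec (d (ap g (s a)) (s b)) (/ INR (S q))) as [Hlt | Hlt].
    2: { exists 0%nat. intros Hf. contradiction. }
    destruct (half_pow_lt (/ INR (S q) - d (ap g (s a)) (s b))) as [K HK]; [lra|].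
    exists (S (max K a)). intros _ g' Hg'. specialize (HK (max K a) ltac:(lia)).
    destruct (proj2 (Ht (max K a)) g' g Hg' (Hin _) a) as [H1 _]; [lia|].
    pose proof (dist_tri (ap g' (s a)) (ap g (s a)) (s b)). lra. }
  apply functional_choice in Hc. destruct Hc as [f Hf].
  exists (fold_right max 0%nat (map f (decode j))).
  intros g' Hg' c Hc. apply Hf; [now apply Hj|].
  assert (Hle : (f c <= fold_right max 0 (map f (decode j)))%nat).
  { revert Hc. clear. induction (decode j) as [|c' l IH]; simpl; [easy|].
    intros [<- | Hc]; [lia | specialize (IH Hc); lia]. }
  replace (fold_right max 0 (map f (decode j)))%nat
    with (fold_right max 0 (map f (decode j)) - f c + f c)%nat in Hg' by lia.
  now apply Hmono in Hg'.
Qed.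

(** * Generic tuples *)

Definition raw (t : nat -> Elt) : nat -> X -> X := fun i => ap (t i).

Definition scons {T : Type} (y : T) (hb : nat -> T) : nat -> T :=
  fun i => match i with O => y | S i => hb i end.

Lemma in_Gn_raw n t : in_Gn G n (raw t).
Proof. intros i _. apply (proj2_sig (t i)). Qed.

Lemma in_Gn_scons n (y : Elt) hb : in_Gn G n hb -> in_Gn G (S n) (scons (ap y) hb).
Proof.
  intros H [|i] Hi; [apply (proj2_sig y) | apply H; lia].
Qed.

Lemma in_Gn_lift n hb : in_Gn G n hb -> exists t, forall i, (i < n)%nat -> ap (t i) = hb i.
Proof.
  intros H. apply (functional_choice (fun i g => (i < n)%nat -> ap g = hb i)).
  intros i. destruct (Nat.lt_ge_cases i n) as [Hi | Hi].
  - exists (exist _ (hb i) (H i Hi)). reflexivity.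
  - exists one. lia.
Qed.

Fixpoint basic_tuple (n j : nat) (t : nat -> Elt) : Prop :=
  match n with
  | O => True
  | S n => basic (fst (of_nat j)) (t 0%nat) /\ basic_tuple n (snd (of_nat j)) (fun i => t (S i))
  end.

Definition near_tuple (n : nat) (F : list X) (delta : R) (t t' : nat -> Elt) : Prop :=
  forall i, (i < n)%nat -> near F delta (t i) (t' i).

Lemma near_tuple_S n F delta t t' :
  near_tuple (S n) F delta t t' <->
  near F delta (t 0%nat) (t' 0%nat) /\
  near_tuple n F delta (fun i => t (S i)) (fun i => t' (S i)).
Proof.
  split.
  - intros H. split; [apply H; lia|]. intros i Hi. apply H. lia.
  - intros [H0 H] [|i] Hi; [exact H0 | apply H; lia].
Qed.

Lemma basic_tuple_near n t F delta : 0 < delta ->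
  exists j, basic_tuple n j t /\ forall t', basic_tuple n j t' -> near_tuple n F delta t t'.
Proof.
  intros Hd. revert t. induction n as [|n IH]; intros t.
  - exists 0%nat. split; [exact I|]. intros t' _ i Hi. lia.
  - destruct (IH (fun i => t (S i))) as [j [Hj1 Hj2]].
    destruct (basic_near (t 0%nat) F delta Hd) as [i [Hi1 Hi2]].
    exists (to_nat (i, j)). cbn [basic_tuple]. rewrite cancel_of_to. cbn [fst snd]. split.
    + split; assumption.
    + intros t' [H1 H2]. apply near_tuple_S. auto.
Qed.

Lemma near_basic_tuple n j t : basic_tuple n j t ->
  exists F delta, 0 < delta /\ forall t', near_tuple n F delta t t' -> basic_tuple n j t'.
Proof.
  revert j t. induction n as [|n IH]; intros j t H.
  - exists nil, 1. split; [lra|]. intros t' _. exact I.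
  - destruct H as [H1 H2]. destruct (IH _ _ H2) as [F [delta [Hd HF]]].
    destruct (near_basic _ _ H1) as [F' [delta' [Hd' HF']]].
    exists (F' ++ F), (Rmin delta' delta). split; [now apply Rmin_glb_lt|].
    intros t' Ht'. apply near_tuple_S in Ht'. destruct Ht' as [Ha Hb]. split.
    + apply HF'. apply near_sub with (3 := Ha); [apply incl_appl, incl_refl | apply Rmin_l].
    + apply HF. intros i Hi.
      apply near_sub with (3 := Hb i Hi); [apply incl_appr, incl_refl | apply Rmin_r].
Qed.

(** Tuples are total functions on [nat]; openness already forces [U] to ignore the coordinates from
    [n] on. *)
Lemma tau_open_agree n U hb hb' : tau_open d G n U -> in_Gn G n hb -> U hb ->
  (forall i, (i < n)%nat -> hb' i = hb i) -> U hb'.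
Proof.
  intros HU Hin Hhb Heq. destruct (HU hb Hin Hhb) as [F [delta [Hd HF]]].
  apply HF. split.
  - intros i Hi. rewrite Heq; auto.
  - intros i x Hi _. rewrite Heq by exact Hi. now rewrite dist_refl.
Qed.

Lemma tau_open_section n U (y : Elt) : tau_open d G (S n) U ->
  tau_open d G n (fun hb => U (scons (ap y) hb)).
Proof.
  intros HU gb Hin Hgb.
  destruct (HU _ (in_Gn_scons n y gb Hin) Hgb) as [F [delta [Hd HF]]].
  exists F, delta. split; [exact Hd|]. intros hb [H1 H2]. apply HF. split.
  - now apply in_Gn_scons.
  - intros [|i] x Hi Hx; simpl; [now rewrite dist_refl | apply H2; [lia | exact Hx]].
Qed.

(** Density puts a point of [U] near any given first coordinate with its tail in the box [j]. By
    openness that same tail serves all nearby first coordinates. *)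
Lemma dense_open_section n U j : tau_open d G (S n) U -> tau_dense d G (S n) U ->
  nowhere_dense basic (fun y => (exists t, basic_tuple n j t) /\
     ~ exists t, basic_tuple n j t /\ U (scons (ap y) (raw t))).
Proof.
  intros Ho Hde i g Hg.
  destruct (classic (exists t, basic_tuple n j t)) as [[t Ht] | Hno].
  2: { exists i, g. repeat split; [exact Hg | intros r; auto | tauto]. }
  destruct (near_basic_tuple n j t Ht) as [F1 [d1 [Hd1 HF1]]].
  destruct (near_basic i g Hg) as [F2 [d2 [Hd2 HF2]]].
  destruct (Hde (raw (scons g t)) (F1 ++ F2) (Rmin d1 d2)) as [hb [[Hin Hhb] HU]].
  { apply in_Gn_raw. }
  { now apply Rmin_glb_lt. }
  destruct (in_Gn_lift (S n) hb Hin) as [t' Ht'].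
  assert (Hnear : near_tuple (S n) (F1 ++ F2) (Rmin d1 d2) (scons g t) t').
  { intros k Hk p Hp. rewrite Ht' by exact Hk. apply (Hhb k p Hk Hp). }
  apply near_tuple_S in Hnear. destruct Hnear as [Hn0 HnS].
  set (y := t' 0%nat) in *. set (t'' := fun k => t' (S k)) in *.
  assert (HU' : U (scons (ap y) (raw t''))).
  { apply tau_open_agree with (n := S n) (hb := hb); auto.
    intros [|k] Hk; apply Ht'; exact Hk. }
  assert (Hy : basic i y).
  { apply HF2. apply near_sub with (3 := Hn0); [apply incl_appr, incl_refl | apply Rmin_r]. }
  assert (Ht'' : basic_tuple n j t'').
  { apply HF1. intros k Hk.
    apply near_sub with (3 := HnS k Hk); [apply incl_appl, incl_refl | apply Rmin_l]. }
  destruct (Ho (scons (ap y) (raw t''))) as [F3 [d3 [Hd3 HF3]]].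
  { apply in_Gn_scons, in_Gn_raw. }
  { exact HU'. }
  destruct (basic_near y F3 d3 Hd3) as [k [Hk1 Hk2]].
  destruct (basic_inter_elt i k y Hy Hk1) as [m [Hm [Hmi Hmk]]].
  exists m, y. split; [exact Hm|]. split; [exact Hmi|].
  intros r Hr [_ Hno]. apply Hno. exists t''. split; [exact Ht''|].
  apply HF3. split; [apply in_Gn_scons, in_Gn_raw|].
  intros [|c] x Hc Hx; simpl.
  - apply (Hk2 r); auto.
  - now rewrite dist_refl.
Qed.

(* Kuratowski-Ulam, in the easy direction *)
Lemma comeagre_sections n A : tau_comeagre d G (S n) A ->
  meagre basic (fun y : Elt => ~ tau_comeagre d G n (fun hb => A (scons (ap y) hb))).
Proof.
  intros [U [HU HA]].
  (* For [y] outside all of these nowhere dense sets, the section of each [U m] meets every nonempty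
     box, hence is dense. *)
  set (Z := fun m j y => (exists t, basic_tuple n j t) /\
              ~ exists t, basic_tuple n j t /\ U m (scons (ap y) (raw t))).
  apply meagre_sub with (fun y => exists m j, Z m j y).
  2: { apply (meagre_bigcup basic (fun m y => exists j, Z m j y)). intros m.
       apply (meagre_bigcup basic (fun j y => Z m j y)). intros j.
       apply meagre_nowhere_dense, dense_open_section; apply HU. }
  intros y Hy. apply NNPP. intros Hno. apply Hy.
  exists (fun m hb => U m (scons (ap y) hb)). split.
  - intros m. split; [apply tau_open_section, HU|].
    intros gb F delta Hin Hd. destruct (in_Gn_lift n gb Hin) as [t Ht].
    destruct (basic_tuple_near n t F delta Hd) as [j [Hj1 Hj2]].
    assert (Hex : exists t', basic_tuple n j t' /\ U m (scons (ap y) (raw t'))).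
    { apply NNPP. intros Hno'. apply Hno. exists m, j. split; [now exists t | exact Hno']. }
    destruct Hex as [t' [Ht'1 Ht'2]]. exists (raw t'). split; [|exact Ht'2].
    split; [apply in_Gn_raw|]. intros i x Hi Hx. rewrite <- (Ht i Hi).
    now apply (Hj2 t' Ht'1 i Hi).
  - intros hb Hin Hhb. apply HA; [now apply in_Gn_scons | exact Hhb].
Qed.

(** The zeroth power is a single point up to irrelevant coordinates, so a dense open set is
    everything. *)
Lemma comeagre_0 A hb : tau_comeagre d G 0 A -> A hb.
Proof.
  intros [U [HU HA]]. apply HA; [intros i Hi; lia|]. intros m. destruct (HU m) as [Ho Hde].
  destruct (Hde hb nil 1) as [hb' [_ Hhb']]; [intros i Hi; lia | lra |].
  apply tau_open_agree with (n := 0%nat) (hb := hb'); auto; intros i Hi; lia.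
Qed.

(** * Uniform closeness, conjugation, and approximately generic lists *)

(** The inequality is non-strict so that the relation survives pointwise limits. *)
Definition close (e : R) (g h : Elt) : Prop := forall p, d (ap g p) (ap h p) <= e.

Definition conj (k g : Elt) : Elt := mul (mul k g) (inv k).

Lemma close_sym e g h : close e g h -> close e h g.
Proof. intros H p. rewrite dist_sym. apply H. Qed.

Lemma close_trans e e' g h k : close e g h -> close e' h k -> close (e + e') g k.
Proof.
  intros H H' p. pose proof (dist_tri (ap g p) (ap h p) (ap k p)).
  specialize (H p). specialize (H' p). lra.
Qed.

Lemma close_mul_l e f g h : close e g h -> close e (mul f g) (mul f h).
Proof. intros H p. simpl. rewrite ap_iso. apply H. Qed.

Lemma close_mul_r e f g h : close e g h -> close e (mul g f) (mul h f).
Proof. intros H p. simpl. apply H. Qed.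

Lemma close_conj e f g h : close e g h -> close e (conj f g) (conj f h).
Proof. intros H. now apply close_mul_r, close_mul_l. Qed.

Lemma conj_conj f g h : conj f (conj g h) = conj (mul f g) h.
Proof. apply elt_ext. intros x. simpl. now rewrite inv_mul. Qed.

Lemma close_conj_limit e k g y :
  (forall F delta, 0 < delta -> exists k' y', near F delta k k' /\ near F delta y y' /\
     close e (conj k' g) y') ->
  close e (conj k g) y.
Proof.
  intros H p. apply le_epsilon. intros eta Heta.
  set (q := ap (inv k) p).
  (* The three points pay for replacing [y] by [y'] at [p], the inverse of [k] by that of [k'] at
     [p], and [k] by [k'] at [ap g q]. *)
  destruct (H (p :: q :: ap g q :: nil) (eta/3)) as [k' [y' [Hk [Hy Hc]]]]; [lra|].
  assert (H1 : d (ap k' q) (ap k q) < eta/3) by (apply Hk; simpl; tauto).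
  assert (H2 : d (ap k' (ap g q)) (ap k (ap g q)) < eta/3) by (apply Hk; simpl; tauto).
  assert (H3 : d (ap y' p) (ap y p) < eta/3) by (apply Hy; simpl; tauto).
  specialize (Hc p). simpl in Hc |- *. fold q.
  assert (H4 : d (ap k' (ap g q)) (ap k' (ap g (ap (inv k') p))) < eta/3).
  { rewrite !ap_iso, inv_iso_r. unfold q at 2 in H1. now rewrite ap_inv in H1. }
  pose proof (dist_tri (ap k (ap g q)) (ap k' (ap g q)) (ap y p)).
  pose proof (dist_tri (ap k' (ap g q)) (ap k' (ap g (ap (inv k') p))) (ap y p)).
  pose proof (dist_tri (ap k' (ap g (ap (inv k') p))) (ap y' p) (ap y p)).
  rewrite (dist_sym (ap k (ap g q)) (ap k' (ap g q))) in *. lra.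
Qed.

Fixpoint app_seq (l : list Elt) (z : nat -> X -> X) : nat -> X -> X :=
  match l with
  | nil => z
  | y :: l => scons (ap y) (app_seq l z)
  end.

Lemma app_seq_snoc l y z : app_seq (l ++ y :: nil) z = app_seq l (scons (ap y) z).
Proof. induction l as [|a l IH]; simpl; [reflexivity | now rewrite IH]. Qed.

Lemma app_seq_nth l z i : (i < length l)%nat -> app_seq l z i = ap (nth i l one).
Proof.
  revert i. induction l as [|a l IH]; simpl; intros i Hi; [lia|].
  destruct i as [|i]; simpl; [reflexivity|]. apply IH. lia.
Qed.

Lemma app_seq_length l z : app_seq l z (length l) = z 0%nat.
Proof. induction l as [|a l IH]; simpl; auto. Qed.

(** Approximate genericity in hereditary form: for every length [m] and precision, almost every
    continuation of [l] by [m] elements is near one conjugacy orbit. All [m] are demanded at once so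
    that the property can be extended one element at a time. *)
Definition good (l : list Elt) : Prop :=
  forall m q, exists gb, in_Gn G (length l + m) gb /\
    tau_comeagre d G m (fun z =>
      nbhd_n d G (length l + m) (conj_orbit G (length l + m) gb) (/ INR (S q)) (app_seq l z)).

Lemma good_nil : ample_generics d G -> good nil.
Proof.
  intros H m q. apply H. apply Rinv_0_lt_compat, lt_0_INR. lia.
Qed.

(** For each of the countably many pairs [m], [q], goodness of [l] at [S m] passes to almost every
    first new coordinate by [comeagre_sections]. *)
Lemma good_snoc l : good l -> meagre basic (fun y => ~ good (l ++ y :: nil)).
Proof.
  intros Hl.
  apply meagre_sub with (fun y => exists m q, ~ exists gb, in_Gn G (length l + S m) gb /\
    tau_comeagre d G m (fun z => nbhd_n d G (length l + S m)
      (conj_orbit G (length l + S m) gb) (/ INR (S q)) (app_seq l (scons (ap y) z)))).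
  - intros y Hy. apply NNPP. intros Hno. apply Hy. intros m q.
    apply NNPP. intros Hno'. apply Hno. exists m, q. intros [gb [H1 H2]]. apply Hno'.
    exists gb. rewrite length_app. simpl length.
    replace (length l + 1 + m)%nat with (length l + S m)%nat by lia.
    split; [exact H1|]. destruct H2 as [U [HU HA]]. exists U. split; [exact HU|].
    intros hb. rewrite app_seq_snoc. apply HA.
  - apply (meagre_bigcup basic (fun m y => exists q, ~ exists gb, in_Gn G (length l + S m) gb /\
    tau_comeagre d G m (fun z => nbhd_n d G (length l + S m)
      (conj_orbit G (length l + S m) gb) (/ INR (S q)) (app_seq l (scons (ap y) z))))).
    intros m.
    apply (meagre_bigcup basic (fun q y => ~ exists gb, in_Gn G (length l + S m) gb /\
    tau_comeagre d G m (fun z => nbhd_n d G (length l + S m)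
      (conj_orbit G (length l + S m) gb) (/ INR (S q)) (app_seq l (scons (ap y) z))))).
    intros q. destruct (Hl (S m) q) as [gb [H1 H2]].
    apply meagre_sub with (2 := comeagre_sections _ _ H2).
    intros y Hy Hc. apply Hy. exists gb. auto.
Qed.

Definition simultaneous (e : R) (gb : nat -> Elt) (l : list Elt) (k y : Elt) : Prop :=
  (forall i, (i < length l)%nat -> close e (conj k (gb i)) (nth i l one)) /\
  close e (conj k (gb (length l))) y.

Lemma good_simultaneous l e : good l -> 0 < e ->
  exists gb, meagre basic (fun y => ~ exists k, simultaneous e gb l k y).
Proof.
  intros Hl He. destruct (inv_INR_lt e He) as [q Hq].
  destruct (Hl 1%nat q) as [gb0 [Hin Hc]].
  destruct (in_Gn_lift _ _ Hin) as [gb Hgb]. exists gb.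
  apply meagre_sub with (2 := comeagre_sections _ _ Hc).
  intros y Hy Hy'. apply Hy.
  (* The constant tuple [one] only fills coordinates beyond the relevant ones. *)
  apply (comeagre_0 _ (raw (fun _ => one))) in Hy'.
  cbv beta in Hy'. set (z := scons (ap y) (raw (fun _ => one))) in Hy'.
  destruct Hy' as [_ [ab [[k [kinv [Hk [_ [_ [H2 H3]]]]]] [delta [Hd Hdist]]]]].
  exists (exist _ k Hk). set (K := exist _ k Hk).
  assert (Hinv : forall x, ap (inv K) x = kinv x).
  { intros x. rewrite <- (H2 x) at 1. apply (inv_ap K). }
  assert (Hclose : forall i g, (i < length l + 1)%nat -> app_seq l z i = ap g ->
            close e (conj K (gb i)) g).
  { intros i g Hi Hg p. specialize (Hdist i p Hi). rewrite (H3 i Hi), Hg in Hdist.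
    rewrite dist_sym. simpl. rewrite Hinv, (Hgb i Hi). lra. }
  split.
  - intros i Hi. apply Hclose; [lia|]. now apply app_seq_nth.
  - apply Hclose; [lia|]. now rewrite app_seq_length.
Qed.

Lemma simultaneous_closed e gb l : closed_rel basic (simultaneous e gb l).
Proof.
  intros k y H.
  assert (H' : forall F delta, 0 < delta -> exists k' y', near F delta k k' /\
             near F delta y y' /\ simultaneous e gb l k' y').
  { intros F delta Hd. destruct (basic_near k F delta Hd) as [a [Ha1 Ha2]].
    destruct (basic_near y F delta Hd) as [b [Hb1 Hb2]].
    destruct (H a b Ha1 Hb1) as [k' [y' [Hk [Hy HE]]]]. exists k', y'. auto. }
  split.
  - intros i Hi. apply close_conj_limit. intros F delta Hd.
    destruct (H' F delta Hd) as [k' [y' [Hk [_ [HE _]]]]].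
    exists k', (nth i l one). auto using near_refl.
  - apply close_conj_limit. intros F delta Hd.
    destruct (H' F delta Hd) as [k' [y' [Hk [Hy [_ HE]]]]]. exists k', y'. auto.
Qed.

(** Elements within [delta/2] of [g] on the preimages of [F] under [g] have quotients moving [F] by
    less than [delta]. These indices play the role of [I] in [common_section]. *)
Lemma small_quotients_cover F delta g : 0 < delta ->
  exists i, (forall h h', basic i h -> basic i h' ->
      forall p, In p F -> d (ap h (ap (inv h') p)) p < delta) /\ basic i g.
Proof.
  intros Hd.
  destruct (basic_near g (map (ap (inv g)) F) (delta/2)) as [i [Hi1 Hi2]]; [lra|].
  exists i. split; [|exact Hi1]. intros h h' Hh Hh' p Hp.
  assert (Hq : In (ap (inv g) p) (map (ap (inv g)) F)) by now apply in_map.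
  pose proof (Hi2 h Hh _ Hq) as H1. pose proof (Hi2 h' Hh' _ Hq) as H2.
  rewrite ap_inv in H1, H2.
  pose proof (dist_tri (ap h (ap (inv h') p)) (ap h (ap (inv g) p)) p).
  rewrite ap_iso, inv_iso_l, (dist_sym p) in *. lra.
Qed.

Lemma amalgamation_step l A B u F delta e :
  good l -> 0 < delta -> 0 < e -> (exists p, basic u p) ->
  everywhere_nonmeagre basic A u -> everywhere_nonmeagre basic B u ->
  exists a b f, A a /\ B b /\ good (l ++ a :: nil) /\ good (l ++ b :: nil) /\
    (forall p, In p F -> d (ap f p) p < delta) /\
    (forall x, In x l -> close e (conj f x) x) /\
    close e a (conj f b).
Proof.
  intros Hl Hd He Hu HA HB.
  destruct (good_simultaneous l (e/2) Hl) as [gb Hgb]; [lra|].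
  destruct (common_section basic basic_inter_elt refines refines_cover refines_complete
              (simultaneous (e/2) gb l) A B (fun y => good (l ++ y :: nil))
              (fun i => forall h h', basic i h -> basic i h' ->
                 forall p, In p F -> d (ap h (ap (inv h') p)) p < delta) u)
    as [i [a [b [ga [gb' [Hi [Ha [Hga [Hb [Hgb' [Hba [Hbb [[Ea Ea'] [Eb Eb']]]]]]]]]]]]]]; auto.
  - apply simultaneous_closed.
  - now apply good_snoc.
  - intros g. now apply small_quotients_cover.
  (* [ga] carries the reference tuple near [l, a] and [gb'] carries it near [l, b], each within
     [e/2]. The quotient therefore almost fixes [l], sends [b] near [a], and is small on [F] since
     both factors lie in the same basic set. *)
  - exists a, b, (mul ga (inv gb')).
    assert (Hcancel : forall h, conj (mul ga (inv gb')) (conj gb' h) = conj ga h).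
    { intros h. rewrite conj_conj. f_equal. apply elt_ext. intros x. simpl. now rewrite inv_ap. }
    repeat split; auto.
    + intros p Hp. apply Hi; assumption.
    + intros x Hx. apply In_nth with (d := one) in Hx. destruct Hx as [n [Hn <-]].
      replace e with (e/2 + e/2) by lra. apply close_trans with (conj ga (gb n)).
      * rewrite <- Hcancel. apply close_conj, close_sym, Eb, Hn.
      * apply Ea, Hn.
    + replace e with (e/2 + e/2) by lra. apply close_trans with (conj ga (gb (length l))).
      * now apply close_sym.
      * rewrite <- Hcancel. now apply close_conj.
Qed.

(** * The Cantor scheme *)

Lemma scheme_limit (h phi x : nat -> Elt) (e : R) :
  (forall n, h (S n) = mul (h n) (phi n)) ->
  (forall n l, (l <= n)%nat -> d (ap (phi n) (s l)) (s l) < (1/2)^n /\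
     d (ap (phi n) (ap (inv (h n)) (s l))) (ap (inv (h n)) (s l)) < (1/2)^n) ->
  (forall j n, (j < n)%nat -> close (e * (1/2)^n) (conj (phi n) (x j)) (x j)) ->
  exists g, forall j, close (2 * e) (conj g (x j)) (conj (h (S j)) (x j)).
Proof.
  intros Hh Hphi Hx.
  assert (Hcauchy : forall (v : nat -> X) l,
     (forall n, (l <= n)%nat -> d (v (S n)) (v n) < (1/2)^n) ->
     forall eps, 0 < eps -> exists K, forall m n, (K <= m)%nat -> (K <= n)%nat ->
       d (v m) (v n) < eps).
  { intros v l Hv eps He. destruct (half_pow_lt (eps/4)) as [K HK]; [lra|].
    exists (max K l).
    assert (Hone : forall m, (max K l <= m)%nat -> d (v m) (v (max K l)) < eps/2).
    { intros m Hm. specialize (HK (max K l) ltac:(lia)).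
      pose proof (dist_geometric v 1 l) as Hg.
      specialize (Hg ltac:(intros n Hn; specialize (Hv n Hn); lra)
                     (max K l) (m - max K l)%nat ltac:(lia)).
      replace (max K l + (m - max K l))%nat with m in Hg by lia.
      pose proof (half_pow_pos m). lra. }
    intros m n Hm Hn. pose proof (Hone m Hm). pose proof (Hone n Hn).
    pose proof (dist_tri (v m) (v (max K l)) (v n)).
    rewrite (dist_sym (v (max K l)) (v n)) in *. lra. }
  destruct (limit_exists h) as [g Hg].
  { intros l eps He.
    destruct (Hcauchy (fun n => ap (h n) (s l)) l) with (eps := eps) as [K1 HK1]; auto.
    { intros n Hn. rewrite Hh. simpl. rewrite ap_iso. now apply Hphi. }
    destruct (Hcauchy (fun n => ap (inv (h n)) (s l)) l) with (eps := eps) as [K2 HK2]; auto.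
    (* Here smallness of [phi n] at the preimages under [h n] is used: it makes the inverses of the
       partial products Cauchy. *)
    { intros n Hn. rewrite Hh, inv_mul, inv_iso_l, dist_sym. now apply Hphi. }
    exists (max K1 K2). intros m n Hm Hn. split; [apply HK1 | apply HK2]; lia. }
  exists g. intros j. apply close_conj_limit. intros F delta Hd.
  destruct (tends_to_near h g F delta Hg Hd) as [K HK].
  exists (h (S j + K)%nat), (conj (h (S j)) (x j)). split; [apply HK; lia|].
  split; [now apply near_refl|]. intros p.
  (* Passing from [h n] to [h (S n)] conjugates first by [phi n], which almost fixes [x j];
     invariance of the uniform distance keeps that error, and the errors sum geometrically. *)
  assert (Hstep : forall n, (S j <= n)%nat ->
     d (ap (conj (h (S n)) (x j)) p) (ap (conj (h n) (x j)) p) <= e * (1/2)^n).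
  { intros n Hn. rewrite Hh, <- conj_conj. apply close_conj. apply Hx. lia. }
  pose proof (dist_geometric (fun n => ap (conj (h n) (x j)) p) e (S j) Hstep (S j) K
                (le_n _)) as Hgeo. cbv beta in Hgeo.
  assert (He : 0 <= e * (1/2)^S j).
  { eapply Rle_trans; [apply dist_pos | apply (Hstep (S j)); lia]. }
  pose proof (half_pow_pos (S j)). pose proof (half_pow_pos (S j + K)).
  pose proof (half_pow_le_1 (S j)) as H1.
  set (t := (1/2)^S j) in *. set (t' := (1/2)^(S j + K)) in *.
  assert (He' : 0 <= e).
  { apply Rmult_le_reg_r with t; [assumption|]. now rewrite Rmult_0_l. }
  apply Rle_trans with (1 := Hgeo). nra.
Qed.

Lemma cantor_scheme (A B W : nat -> Elt -> Prop) (u : nat) (e : R) :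
  good nil -> 0 < e -> (exists p, basic u p) ->
  (forall n, everywhere_nonmeagre basic (A n) u) ->
  (forall n, everywhere_nonmeagre basic (B n) u) ->
  (forall g, exists n, W n g) ->
  exists n a b g h, A n a /\ B n b /\ W n g /\ W n h /\ close e (conj g a) (conj h b).
Proof.
  intros Hnil He Hu HA HB HW.
  (* A node at level [n] consists of its list [l] and the product [h] so far; [r] returns both
     candidates [a], [b] and the element [f]. Choosing [r] as a function of the node makes branches
     with a common prefix share their nodes. *)
  set (Q := fun (t : nat * (list Elt * Elt)) (r : Elt * Elt * Elt) =>
    let n := fst t in let l := fst (snd t) in let h := snd (snd t) in
    let a := fst (fst r) in let b := snd (fst r) in let f := snd r in
    good l -> A n a /\ B n b /\ good (l ++ a :: nil) /\ good (l ++ b :: nil) /\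
      (forall i, (i <= n)%nat -> d (ap f (s i)) (s i) < (1/2)^n /\
         d (ap f (ap (inv h) (s i))) (ap (inv h) (s i)) < (1/2)^n) /\
      (forall x, In x l -> close (e/5 * (1/2)^n) (conj f x) x) /\
      close (e/5 * (1/2)^n) a (conj f b)).
  assert (HQ : forall t, exists r, Q t r).
  { intros [n [l h]]. destruct (classic (good l)) as [Hl | Hl].
    2: { exists (one, one, one). unfold Q. simpl. tauto. }
    set (L := map s (seq 0 (S n))).
    destruct (amalgamation_step l (A n) (B n) u (L ++ map (ap (inv h)) L) ((1/2)^n)
                (e/5 * (1/2)^n)) as [a [b [f [H1 [H2 [H3 [H4 [H5 [H6 H7]]]]]]]]]; auto.
    - apply half_pow_pos.
    - apply Rmult_lt_0_compat; [lra | apply half_pow_pos].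
    - exists (a, b, f). unfold Q. simpl. intros _. do 4 (split; [assumption|]).
      split; [|now split]. intros i Hi.
      assert (HL : In (s i) L) by (apply in_map, in_seq; lia).
      split; apply H5, in_or_app; [now left | right; now apply in_map]. }
  apply functional_choice in HQ. destruct HQ as [r Hr].
  set (new := fun (al : nat -> bool) (n : nat) (st : list Elt * Elt) =>
    if al n then snd (fst (r (n, st))) else fst (fst (r (n, st)))).
  set (rot := fun (al : nat -> bool) (n : nat) (st : list Elt * Elt) =>
    if al n then snd (r (n, st)) else one).
  set (node := fun al => fix node n := match n with
     | O => (nil, one)
     | S n => (fst (node n) ++ new al n (node n) :: nil, mul (snd (node n)) (rot al n (node n)))
     end).
  assert (Hgood : forall al n, good (fst (node al n))).
  { intros al n. induction n as [|n IH]; [exact Hnil|]. cbn [node fst].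
    pose proof (Hr (n, node al n) IH) as H. cbn [fst snd] in H.
    unfold new. destruct (al n); apply H. }
  assert (Hagree : forall al be n, (forall i, (i < n)%nat -> al i = be i) ->
            node al n = node be n).
  { intros al be n. induction n as [|n IH]; intros H; [reflexivity|]. cbn [node].
    rewrite IH by (intros i Hi; apply H; lia). unfold new, rot.
    rewrite (H n) by lia. reflexivity. }
  assert (Hlim : forall al, exists g, forall j,
     close (2 * (e/5)) (conj g (new al j (node al j)))
                       (conj (snd (node al (S j))) (new al j (node al j)))).
  { intros al.
    apply (scheme_limit (fun n => snd (node al n)) (fun n => rot al n (node al n))
             (fun n => new al n (node al n)) (e/5)).
    - reflexivity.
    - intros n l Hl. unfold rot. destruct (al n).
      + now apply (Hr (n, node al n) (Hgood al n)).
      + simpl. rewrite !dist_refl. split; apply half_pow_pos.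
    - intros j n Hj. unfold rot. destruct (al n).
      + apply (Hr (n, node al n) (Hgood al n)). simpl.
        induction n as [|n IH]; [lia|]. cbn [node fst]. apply in_or_app.
        destruct (Nat.eq_dec j n) as [-> | Hne]; [right; now left|].
        left. apply IH. lia.
      + intros p. simpl. rewrite (inv_unique one one) by reflexivity. simpl.
        rewrite dist_refl. pose proof (half_pow_pos n). nra. }
  apply functional_choice in Hlim. destruct Hlim as [lim Hlim].
  destruct (split_branches (fun n al => W n (lim al))) as [n [al [be [Hab [Hal [Hbe [Wal Wbe]]]]]]].
  { intros al. apply HW. }
  pose proof (Hr (n, node al n) (Hgood al n)) as Hn. cbn [fst snd] in Hn.
  destruct Hn as [Ha [Hb [_ [_ [_ [_ Hc]]]]]].
  pose proof (Hlim al n) as Lal. pose proof (Hlim be n) as Lbe.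
  cbn [node snd] in Lal, Lbe. rewrite <- (Hagree al be n Hab) in Lbe.
  unfold new, rot in Lal, Lbe. rewrite Hal in Lal. rewrite Hbe in Lbe.
  set (a := fst (fst (r (n, node al n)))) in *. set (b := snd (fst (r (n, node al n)))) in *.
  set (f := snd (r (n, node al n))) in *. set (h := snd (node al n)) in *.
  exists n, a, b, (lim al), (lim be). do 4 (split; [assumption|]).
  assert (Hone : conj (mul h one) a = conj h a).
  { f_equal. apply elt_ext. reflexivity. }
  rewrite Hone in Lal. rewrite <- conj_conj in Lbe.
  (* The budget: [2 * (e/5)] for passing to the limit along each branch, and [e/5] for comparing [a]
     with [conj f b] at the splitting node. *)
  replace e with (2 * (e/5) + (e/5 + 2 * (e/5))) by lra.
  apply close_trans with (conj h a); [exact Lal|].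
  apply close_trans with (conj h (conj f b)); [|now apply close_sym].
  apply close_conj. intros p. apply Rle_trans with (1 := Hc p).
  pose proof (half_pow_le_1 n) as H1.
  nra.
Qed.

(** * Covering the group *)

Lemma basic_translate k i g : basic i (mul k g) ->
  exists j, basic j g /\ forall g', basic j g' -> basic i (mul k g').
Proof.
  intros H. destruct (near_basic i _ H) as [F [delta [Hd HF]]].
  destruct (basic_near g F delta Hd) as [j [Hj1 Hj2]]. exists j. split; [exact Hj1|].
  intros g' Hg'. apply HF. intros p Hp. simpl. rewrite ap_iso. now apply (Hj2 g').
Qed.

Lemma mul_inv_cancel k g : mul k (mul (inv k) g) = g.
Proof. apply elt_ext. intros x. simpl. apply ap_inv. Qed.

Lemma inv_mul_cancel k g : mul (inv k) (mul k g) = g.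
Proof. apply elt_ext. intros x. simpl. apply inv_ap. Qed.

Lemma meagre_translate k A : meagre basic A -> meagre basic (fun g => A (mul k g)).
Proof.
  intros [F [HF HA]]. exists (fun n g => F n (mul k g)). split; [|intros p Hp; now apply HA].
  intros n i p Hp. rewrite <- (inv_mul_cancel k p) in Hp.
  destruct (basic_translate _ _ _ Hp) as [j [Hj1 Hj2]].
  destruct (HF n j _ Hj1) as [j' [q [Hq [Hsub Hav]]]].
  rewrite <- (mul_inv_cancel k q) in Hq.
  destruct (basic_translate _ _ _ Hq) as [m [Hm1 Hm2]].
  exists m, (mul (inv k) q). split; [exact Hm1|]. split.
  - intros r Hr. rewrite <- (inv_mul_cancel k r). apply Hj2, Hsub, Hm2, Hr.
  - intros r Hr. apply Hav, Hm2, Hr.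
Qed.

Lemma everywhere_nonmeagre_translate k A u v :
  (forall g, basic v g -> basic u (mul (inv k) g)) ->
  everywhere_nonmeagre basic A u ->
  everywhere_nonmeagre basic (fun g => A (mul (inv k) g)) v.
Proof.
  intros Huv HA j q Hq Hjv Hm. apply (meagre_translate k) in Hm.
  rewrite <- (mul_inv_cancel k q) in Hq.
  destruct (basic_translate _ _ _ Hq) as [m [Hm1 Hm2]].
  apply (HA m _ Hm1).
  - intros r Hr. rewrite <- (inv_mul_cancel k r). apply Huv, Hjv, Hm2, Hr.
  - apply meagre_sub with (2 := Hm). intros p [Hp1 Hp2]. rewrite inv_mul_cancel. auto.
Qed.

Definition prod_list (l : list Elt) : Elt := fold_right mul one l.

Lemma identity_neighbourhood (W : nat -> Elt -> Prop) (e : R) :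
  good nil -> 0 < e ->
  (forall n g, W n g -> W (S n) g) ->
  (forall n g, W n g -> W n (inv g)) ->
  (forall g, exists n, W n g) ->
  exists n F delta, 0 < delta /\ forall k, near F delta one k ->
    exists ws, length ws = 6%nat /\ (forall w, In w ws -> W n w) /\ close e k (prod_list ws).
Proof.
  intros Hgood He Hinc Hsym Hex.
  assert (Hinc' : forall n m g, W n g -> W (n + m)%nat g).
  { intros n m g H. induction m as [|m IH]; [now rewrite Nat.add_0_r|].
    rewrite Nat.add_succ_r. auto. }
  assert (Hm0 : exists m, ~ meagre basic (W m)).
  { apply NNPP. intros Hno. destruct (basic_near one nil 1) as [i [Hi _]]; [lra|].
    apply (baire basic refines refines_sub refines_mono refines_cover refines_complete one).
    - now exists i.
    - apply meagre_sub with (fun g => exists n, W n g); [auto|].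
      apply meagre_bigcup. intros n. apply NNPP. intros Hn. apply Hno. now exists n. }
  destruct Hm0 as [m0 Hm0].
  destruct (nonmeagre_somewhere basic _ Hm0) as [u [p0 [Hp0 HWu]]].
  destruct (near_basic u p0 Hp0) as [F [delta [Hd HF]]].
  (* One half of [delta] is for moving inside [v], the other for the translation by [k n]; together
     they keep the translate of [v] by the inverse of [k n] inside [u]. *)
  destruct (basic_near p0 F (delta/2)) as [v0 [Hv0 Hv0']]; [lra|].
  destruct (basic_inter_elt u v0 p0 Hp0 Hv0) as [v [Hv [Hvu Hvv0]]].
  apply NNPP. intros Hno.
  assert (Hk : forall n, exists k, near (map (ap p0) F) (delta/2) one k /\
     ~ exists ws, length ws = 6%nat /\ (forall w, In w ws -> W (m0 + n)%nat w) /\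
         close e k (prod_list ws)).
  { intros n. apply NNPP. intros Hn. apply Hno.
    exists (m0 + n)%nat, (map (ap p0) F), (delta/2). split; [lra|].
    intros k Hk. apply NNPP. intros Hk'. apply Hn. now exists k. }
  apply functional_choice in Hk. destruct Hk as [k Hk].
  assert (HW : forall n, everywhere_nonmeagre basic (W (m0 + n)%nat) u).
  { intros n. apply everywhere_nonmeagre_sub with (3 := HWu); [auto | intros r; auto]. }
  destruct (cantor_scheme (fun n => W (m0 + n)%nat) (fun n g => W (m0 + n)%nat (mul (inv (k n)) g))
              (fun n => W (m0 + n)%nat) v e) as [n [a [b [g [h [Ha [Hb [Hg [Hh Hc]]]]]]]]]; auto.
  - now exists p0.
  - intros n. apply everywhere_nonmeagre_sub with (3 := HW n); auto.
  - intros n. apply everywhere_nonmeagre_translate with (2 := HW n).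
    intros g Hg. apply HF. intros p Hp. simpl.
    rewrite inv_iso_l.
    pose proof (Hv0' g (Hvv0 g Hg) p Hp) as H1.
    pose proof (proj1 (Hk n) (ap p0 p) (in_map _ _ _ Hp)) as H2. simpl in H2.
    pose proof (dist_tri (ap g p) (ap p0 p) (ap (k n) (ap p0 p))).
    rewrite (dist_sym (ap p0 p) (ap (k n) (ap p0 p))) in *. lra.
  - intros g. destruct (Hex g) as [n Hn]. exists n. rewrite Nat.add_comm. auto.
  - apply (proj2 (Hk n)). set (w := mul (inv (k n)) b) in *.
    (* With [b] equal to [k n] times [w], conjugating both sides of [Hc] by [inv h] and cancelling
       [w] on the right isolates [k n]. *)
    exists (inv h :: g :: a :: inv g :: h :: inv w :: nil). split; [reflexivity|]. split.
    + intros w' Hw'. simpl in Hw'. intuition (subst; auto).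
    + apply (close_conj _ (inv h)) in Hc. apply (close_mul_r _ (inv w)) in Hc.
      apply close_sym. intros p. specialize (Hc p). simpl in Hc |- *.
      rewrite !inv_inv, !inv_ap in Hc.
      replace (ap (k n) p) with (ap b (ap (inv w) p)); [exact Hc|].
      unfold w. rewrite inv_mul, inv_inv. apply ap_inv.
Qed.

(** The double coset of [g] is governed by the tuple formed of [F] and its image under [g].
    Oligomorphy leaves finitely many approximate orbits of such tuples, and [L] holds one
    representative for each orbit that occurs. *)
Lemma finitely_many_double_cosets F delta : approx_oligomorphic d G -> 0 < delta ->
  exists L : list Elt, forall g, exists h g' f, near F delta one h /\ In g' L /\
    near F delta one f /\ g = mul (mul h g') f.
Proof.
  intros Hol Hd. set (n := length F).
  set (tup := fun (g : Elt) i =>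
    if Nat.ltb i n then nth i F (s 0%nat) else ap g (nth (i - n)%nat F (s 0%nat))).
  destruct (Hol (n + n)%nat (delta/3)) as [bs Hbs]; [lra|].
  set (Q := fun (b : nat -> X) (g : Elt) =>
    exists k : Elt, forall i, (i < n + n)%nat -> d (ap k (b i)) (tup g i) <= delta/3).
  assert (HL : exists L : list Elt, forall b g, In b bs -> Q b g -> exists g', In g' L /\ Q b g').
  { clear Hbs. induction bs as [|b bs [L HL]].
    - exists nil. intros b g [].
    - destruct (classic (exists g, Q b g)) as [[g0 Hg0] | Hno].
      + exists (g0 :: L). intros b' g [<- | Hb'] Hg.
        * exists g0. split; [now left | exact Hg0].
        * destruct (HL b' g Hb' Hg) as [g' [H1 H2]]. exists g'. split; [now right | exact H2].
      + exists L. intros b' g [<- | Hb'] Hg; [exfalso; apply Hno; now exists g|].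
        now apply HL with g. }
  destruct HL as [L HL]. exists L. intros g.
  destruct (Hbs (tup g)) as [b [k0 [Hb [Hk0 Hk]]]].
  assert (Hlift : exists k : Elt, ap k = k0) by now exists (exist _ k0 Hk0).
  destruct Hlift as [k <-].
  destruct (HL b g Hb) as [g' [Hg' [k' Hk']]]; [now exists k|].
  (* [h] moves the tuple of [g'] near that of [g]. The first half of the coordinates says that [h]
     is near the identity on [F], the second that [mul h g'] is near [g] on [F]. *)
  set (h := mul k (inv k')).
  assert (Hh : forall i, (i < n + n)%nat -> d (ap h (tup g' i)) (tup g i) < delta).
  { intros i Hi. specialize (Hk i Hi). specialize (Hk' i Hi).
    simpl.
    pose proof (dist_tri (ap k (ap (inv k') (tup g' i))) (ap k (b i)) (tup g i)).
    assert (d (ap k (ap (inv k') (tup g' i))) (ap k (b i)) <= delta/3).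
    { now rewrite ap_iso, inv_iso_l, dist_sym. }
    lra. }
  exists h, g', (mul (inv (mul h g')) g). split; [|split; [exact Hg'|split]].
  - intros p Hp. apply In_nth with (d := s 0%nat) in Hp. destruct Hp as [i [Hi <-]].
    specialize (Hh i ltac:(unfold n; lia)). unfold tup in Hh.
    destruct (Nat.ltb_spec i n); [exact Hh | unfold n in *; lia].
  - intros p Hp. apply In_nth with (d := s 0%nat) in Hp. destruct Hp as [i [Hi <-]].
    fold n in Hi. specialize (Hh (i + n)%nat ltac:(lia)). unfold tup in Hh.
    destruct (Nat.ltb_spec (i + n) n); [lia|].
    replace (i + n - n)%nat with i in Hh by lia. simpl. rewrite inv_iso_l.
    rewrite dist_sym. exact Hh.
  - symmetry. apply mul_inv_cancel.
Qed.

Lemma prod_list_app l l' : prod_list (l ++ l') = mul (prod_list l) (prod_list l').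
Proof.
  induction l as [|a l IH]; simpl; [now apply elt_ext|]. rewrite IH. now apply elt_ext.
Qed.

Lemma prod_list_repeat_one n : prod_list (repeat one n) = one.
Proof. induction n as [|n IH]; simpl; [reflexivity|]. rewrite IH. now apply elt_ext. Qed.

Lemma compose_list_ap l : compose_list (map ap l) = ap (prod_list l).
Proof.
  induction l as [|a l IH]; [reflexivity|].
  change (compose_list (map ap (a :: l))) with (fun x => ap a (compose_list (map ap l) x)).
  now rewrite IH.
Qed.

(* Uniform distance being left and right invariant, the whole error of an
   approximate factorization can be moved into the first factor. *)
Lemma exact_factorization (V : Elt -> Prop) e k ws : ws <> nil -> 0 <= e ->
  (forall w, In w ws -> V w) -> close e k (prod_list ws) ->
  exists hs, length hs = length ws /\
    (forall h, In h hs -> exists w, V w /\ close e h w) /\ prod_list hs = k.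
Proof.
  intros Hne He HV Hk. destruct ws as [|w t]; [contradiction|].
  exists (mul k (inv (prod_list t)) :: t). split; [reflexivity|]. split.
  - intros h [<- | Hh].
    + exists w. split; [apply HV; now left|].
      apply (close_mul_r _ (inv (prod_list t))) in Hk.
      intros p. specialize (Hk p). simpl in Hk |- *. now rewrite ap_inv in Hk.
    + exists h. split; [apply HV; now right|]. intros p. now rewrite dist_refl.
  - apply elt_ext. intros x. simpl. now rewrite inv_ap.
Qed.

Lemma bergman : approx_oligomorphic d G -> ample_generics d G -> metrically_bergman d G 21.
Proof.
  intros Hol Hag W HWG Hinc Hex eps He.
  assert (Hle : forall n m g, (n <= m)%nat -> W n g -> W m g).
  { intros n m g H Hg. induction H; auto. }
  (* The symmetric core of [W n] is still increasing and exhaustive, so inverses of its elements are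
     available as factors. *)
  set (V := fun n (g : Elt) => W n (ap g) /\ W n (ap (inv g))).
  assert (HVle : forall n m g, (n <= m)%nat -> V n g -> V m g).
  { intros n m g H [H1 H2]. split; eapply Hle; eauto. }
  assert (HVex : forall g, exists n, V n g).
  { intros g. destruct (Hex (ap g) (proj2_sig g)) as [n1 H1].
    destruct (Hex (ap (inv g)) (proj2_sig (inv g))) as [n2 H2].
    exists (max n1 n2). split; [apply Hle with n1 | apply Hle with n2]; auto; lia. }
  (* Halving [eps] leaves the strict margin that [sup_dist_lt] demands. *)
  destruct (identity_neighbourhood V (eps/2)) as [n [F [delta [Hd Hn]]]]; auto.
  - now apply good_nil.
  - lra.
  - intros n g H. apply HVle with n; auto.
  - intros n g [H1 H2]. split; [exact H2 | now rewrite inv_inv].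
  - destruct (finitely_many_double_cosets F delta Hol Hd) as [L HL].
    assert (Hm : exists m, (n <= m)%nat /\ forall g, In g (one :: L) -> V m g).
    { clear HL. induction (one :: L) as [|g l [m [Hm1 Hm2]]].
      - exists n. split; [lia | intros g []].
      - destruct (HVex g) as [m' Hm']. exists (max m m'). split; [lia|].
        intros g' [<- | Hg']; [apply HVle with m' | apply HVle with m]; auto; lia. }
    destruct Hm as [m [Hnm Hm]]. exists m. intros g0 Hg0.
    set (g := exist _ g0 Hg0 : Elt).
    destruct (HL g) as [h [g' [f [Hh [Hg' [Hf Heq]]]]]].
    assert (Hfac : forall k, near F delta one k -> exists hs, length hs = 6%nat /\
       (forall x, In x hs -> exists w, V m w /\ close (eps/2) x w) /\ prod_list hs = k).
    { intros k Hk. destruct (Hn k Hk) as [ws [Hlen [HV Hc]]]. rewrite <- Hlen.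
      apply exact_factorization; auto.
      - intros ->. discriminate.
      - lra.
      - intros w Hw. apply HVle with n; auto. }
    destruct (Hfac h Hh) as [hs1 [Hlen1 [Hhs1 Hp1]]].
    destruct (Hfac f Hf) as [hs2 [Hlen2 [Hhs2 Hp2]]].
    (* Six factors for [h], one for [g'] and six for [f] make 13; eight copies of [one], which was
       put into [V m] together with [L], pad the product to 21. *)
    set (l := (hs1 ++ g' :: nil) ++ hs2 ++ repeat one 8).
    exists (map ap l). split; [|split].
    + unfold l. rewrite length_map, !length_app, repeat_length, Hlen1, Hlen2. reflexivity.
    + intros x Hx. apply in_map_iff in Hx. destruct Hx as [y [<- Hy]].
      split; [apply (proj2_sig y)|].
      assert (Hw : exists w, V m w /\ close (eps/2) y w).
      { assert (Hself : forall z, In z (one :: L) -> exists w, V m w /\ close (eps/2) z w).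
        { intros z Hz. exists z. split; [now apply Hm|]. intros p. rewrite dist_refl. lra. }
        unfold l in Hy. apply in_app_or in Hy. destruct Hy as [Hy | Hy];
          apply in_app_or in Hy; destruct Hy as [Hy | Hy]; auto.
        - destruct Hy as [<- | []]. apply Hself. now right.
        - apply repeat_spec in Hy. subst y. apply Hself. now left. }
      destruct Hw as [w [[Hw _] Hc]]. exists (ap w). split; [exact Hw|].
      exists (eps/2). split; [lra | exact Hc].
    + rewrite compose_list_ap. change g0 with (ap g). f_equal.
      unfold l. rewrite !prod_list_app, prod_list_repeat_one, Hp1, Hp2, Heq.
      now apply elt_ext.
Qed.

End IsometryGroup.

Theorem theorem4p13 (X : Type) (d : X -> X -> R) (G : (X -> X) -> Prop) :
  polish_metric d ->
  iso_subgroup d G ->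
  pointwise_closed_in_iso d G ->
  approx_oligomorphic d G ->
  ample_generics d G ->
  metrically_bergman d G 21.
Proof.
  intros [Hm [Hc [s Hs]]] Hsub Hcl. exact (bergman d G Hm Hc s Hs Hsub Hcl).
Qed.
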